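(* The problem Transversal($\alpha$) is solvable in polynomial time when the input graph is restricted to be a co-comparability graph. That is, there is a polynomial-time algorithm which, given a co-comparability graph $G=(V,E)$ and two integers $d,k\geq 1$, decides whether there exists a set $S\subseteq V$ with $|S|\leq k$ such that $|I\cap S|\geq d$ for every maximum independent set $I$ of $G$.
   Context: All graphs are finite and undirected, without self-loops or multiple edges. A comparability graph is a graph $H=(V,F)$ admitting a transitive ordering of its vertices, i.e. a linear ordering $\prec$ of $V$ such that if $u\prec v\prec w$ and $uv,vw\in F$, then $uw\in F$. A co-comparability graph is the complement of a comparability graph. A maximum independent set of $G$ is an independent set (set of pairwise non-adjacent vertices) of the largest possible size $\alpha(G)$. Problem Transversal($\alpha$). Instance: a graph $G=(V,E)$ and two integers $d,k\geq 1$. Question: is there a set $S\subseteq V$ with $|S|\leq k$ such that for every maximum independent set $I$ of $G$ we have $|I\cap S|\geq d$? *)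

(* Defs.v *)
From mathcomp Require Import all_boot all_order all_algebra.

Set Implicit Arguments.
Unset Strict Implicit.
Unset Printing Implicit Defensive.

(** * Polynomial time

    Random access machine over natural numbers, with programs in structured
    form.  Every elementary operation costs one unit whatever the size of its
    operands.  There is deliberately no multiplication: after t steps a cell
    then holds a number with O(t + input length) bits, so that polynomial time
    on this machine is polynomial time on a Turing machine. *)

Inductive expr : Type :=
  | Const of nat
  | Read of expr            (* indirect addressing *)
  | Add of expr & expr
  | Sub of expr & expr.     (* truncated *)

Inductive program : Type :=
  | Skip
  | Write of expr & expr    (* address, value *)
  | Seq of program & program
  | If of expr & program & program
  | While of expr & program.

Definition memory : Type := nat -> nat.

Definition update (m : memory) (a v : nat) : memory :=
  fun b => if b == a then v else m b.

Fixpoint eval (m : memory) (e : expr) : nat :=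
  match e with
  | Const n => n
  | Read e1 => m (eval m e1)
  | Add e1 e2 => eval m e1 + eval m e2
  | Sub e1 e2 => eval m e1 - eval m e2
  end.

Fixpoint cost (e : expr) : nat :=
  match e with
  | Const _ => 1
  | Read e1 => (cost e1).+1
  | Add e1 e2 | Sub e1 e2 => (cost e1 + cost e2).+1
  end.

(** [exec c m t m']: started in [m], the program [c] halts in [m'] after [t]
    elementary steps.  In conditions, nonzero means true. *)
Inductive exec : program -> memory -> nat -> memory -> Prop :=
  | ExecSkip m : exec Skip m 1 m
  | ExecWrite a e m :
      exec (Write a e) m (cost a + cost e).+1 (update m (eval m a) (eval m e))
  | ExecSeq c1 c2 m t1 m1 t2 m2 :
      exec c1 m t1 m1 -> exec c2 m1 t2 m2 -> exec (Seq c1 c2) m (t1 + t2) m2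
  | ExecIfTrue e c1 c2 m t m1 :
      eval m e != 0 -> exec c1 m t m1 -> exec (If e c1 c2) m (cost e + t).+1 m1
  | ExecIfFalse e c1 c2 m t m1 :
      eval m e = 0 -> exec c2 m t m1 -> exec (If e c1 c2) m (cost e + t).+1 m1
  | ExecWhileTrue e c m t1 m1 t2 m2 :
      eval m e != 0 -> exec c m t1 m1 -> exec (While e c) m1 t2 m2 ->
      exec (While e c) m (cost e + t1 + t2).+1 m2
  | ExecWhileFalse e c m :
      eval m e = 0 -> exec (While e c) m (cost e).+1 m.

Definition load (s : seq nat) : memory := nth 0 s.

Definition bit_length (a : nat) : nat := (trunc_log 2 a).+1.

Definition input_length (s : seq nat) : nat := \sum_(a <- s) bit_length a.

(** Inputs outside [promise] are unconstrained: the program need not recognize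
    them, nor even halt on them.  The answer is read in cell 0. *)
Definition poly_time_decidable (X : Type) (encode : X -> seq nat)
    (promise yes : X -> Prop) : Prop :=
  exists (c : program) (p : {poly nat}), forall x : X, promise x ->
    exists (t : nat) (m : memory),
      [/\ exec c (load (encode x)) t m,
          t <= (p.[input_length (encode x)])%R &
          (m 0 = 1 /\ yes x) \/ (m 0 = 0 /\ ~ yes x)].

(** * Graphs *)

Record sgraph (T : finType) : Type := SGraph {
  adj : rel T;
  adj_sym : symmetric adj;
  adj_irr : irreflexive adj
}.

Section Graphs.
Variable T : finType.
Implicit Types (G H : sgraph T) (I S : {set T}).

Definition compl_adj G : rel T := fun u v => (u != v) && ~~ adj G u v.

Lemma compl_adj_sym G : symmetric (compl_adj G).
Proof. by move=> u v; rewrite /compl_adj eq_sym adj_sym. Qed.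

Lemma compl_adj_irr G : irreflexive (compl_adj G).
Proof. by move=> u; rewrite /compl_adj eqxx. Qed.

Definition complement G : sgraph T :=
  SGraph (@compl_adj_sym G) (@compl_adj_irr G).

Definition strict_linear_order (lt : rel T) : Prop :=
  [/\ irreflexive lt, transitive lt & forall u v, u != v -> lt u v || lt v u].

Definition transitive_ordering H (lt : rel T) : Prop :=
  strict_linear_order lt /\
  forall u v w, lt u v -> lt v w -> adj H u v -> adj H v w -> adj H u w.

Definition comparability H : Prop := exists lt : rel T, transitive_ordering H lt.

Definition cocomparability G : Prop :=
  exists2 H : sgraph T, comparability H & adj G =2 adj (complement H).

Definition independent G I : bool :=
  [forall u in I, forall v in I, ~~ adj G u v].

Definition alpha G : nat := \max_(I : {set T} | independent G I) #|I|.

Definition maximum_independent G I : bool :=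
  independent G I && (#|I| == alpha G).

Definition has_transversal G (d k : nat) : Prop :=
  exists S : {set T}, #|S| <= k /\
    forall I : {set T}, maximum_independent G I -> d <= #|I :&: S|.

End Graphs.

(** * The problem Transversal(alpha) *)

Record instance : Type := Instance {
  nvert : nat;
  graph : sgraph 'I_nvert;
  dval : nat;
  kval : nat;
  dval_ge1 : 1 <= dval;
  kval_ge1 : 1 <= kval
}.

(** The adjacency matrix is listed row by row; [d] and [k] are written in
    binary, in the sense of [input_length]. *)
Definition encode_instance (x : instance) : seq nat :=
  [:: nvert x, dval x, kval x &
      [seq nat_of_bool (adj (graph x) i j)
         | i <- enum 'I_(nvert x), j <- enum 'I_(nvert x)]].

Definition transversal_alpha (x : instance) : Prop :=
  has_transversal (graph x) (dval x) (kval x).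

(* Main.v *)
(** Maximum independent sets of [G] are the maximum chains of a transitive
    orientation of the complement.  Write [x sq y] when [x <= y] and some maximum
    chain contains both.  Splicing maximum chains at a common element shows that
    [sq] is a partial order on the set [U] of elements of maximum chains, any
    chain of which extends to a maximum chain of [G].  With [q = alpha - d], a set
    [S] meets every maximum chain [d] times iff [U \ S] contains at most [q]
    elements of every chain of [sq], that is, iff [U \ S] lifts to an antichain
    of the product of [U] with a chain of [q] elements (Greene-Kleitman, Saks).
    Antichains of this product are complements of vertex covers of its bipartite
    comparability graph.  Hence, by Koenig's theorem, [S] exists with [|S| <= k]
    iff [d <= alpha] and [|U| + nu <= |U| q + k], where [nu] is the matching number
    of that graph.

    The orientation is the union of implication classes, repeatedly chosen and
    removed (Golumbic): once a class is removed, the rest is still transitively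
    orientable, since the vertices spanned by the class form a module.  The number
    [nu] is found by an auction: an unmatched left vertex takes over its cheapest
    neighbour and raises its price by one; when all bids are blocked, a price level
    taken by no vertex yields a cover of the size of the matching. *)

From mathcomp Require Import all_boot all_order all_algebra.
From mathcomp Require Import zify.
Require Import Defs.

Set Implicit Arguments.
Unset Strict Implicit.
Unset Printing Implicit Defensive.

(** Time is counted only once, for the compiler: an array command runs in time polynomial in [n]
    whatever the arrays contain, and the later lemmas about commands are purely functional. The
    price is that loops have fixed length and cannot stop early, so each search (orientation,
    auction) is iterated more often than a bounded potential can grow, by a step that preserves a
    finished state.

    The numbers [d] and [k] are binary and may be exponential in the input length. They never bound
    a loop and enter only through sums, comparisons and [q = alpha - d]. Since [q] is at most [n],
    the product of [U] with a chain of [q] elements fits into pairs of indices.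

    The program does not know the orientation given by the promise; it only knows that one exists.
    The invariant must therefore survive an arbitrary choice of edge and direction, which is why a
    class has to be compatible with every orientation of the remainder. The relation [sq] quantifies
    over maximum chains; it becomes computable because paths of a transitive orientation are chains,
    so that path lengths determine it. *)

(** * Time-bounded execution of structured programs *)

Definition runs (c : program) (m : memory) (T : nat) (Q : memory -> Prop) :=
  exists t m', [/\ exec c m t m', t <= T & Q m'].

Lemma runs_weaken c m T T' (Q Q' : memory -> Prop) :
  runs c m T Q -> T <= T' -> (forall m', Q m' -> Q' m') -> runs c m T' Q'.
Proof.
move=> [t [m' [e tT Qm]]] TT QQ; exists t, m'; split=> //; first exact: leq_trans TT.
exact: QQ.
Qed.

Lemma runs_skip m (Q : memory -> Prop) : Q m -> runs Skip m 1 Q.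
Proof. by move=> Qm; exists 1, m; split=> //; constructor. Qed.

Lemma runs_write a e m (Q : memory -> Prop) :
  Q (update m (eval m a) (eval m e)) ->
  runs (Write a e) m (cost a + cost e).+1 Q.
Proof. by move=> Qm; eexists; eexists; split; [constructor| |]. Qed.

Lemma runs_seq c1 c2 m T1 T2 (Q : memory -> Prop) :
  runs c1 m T1 (fun m1 => runs c2 m1 T2 Q) -> runs (Seq c1 c2) m (T1 + T2) Q.
Proof.
move=> [t1 [m1 [e1 l1 [t2 [m2 [e2 l2 Qm]]]]]].
exists (t1 + t2), m2; split=> //; last exact: leq_add.
exact: ExecSeq e1 e2.
Qed.

(** The bound adds the two branches instead of taking their maximum, so that it stays polynomial. *)
Lemma runs_if e c1 c2 m T1 T2 (Q : memory -> Prop) :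
  (eval m e != 0 -> runs c1 m T1 Q) -> (eval m e = 0 -> runs c2 m T2 Q) ->
  runs (If e c1 c2) m (cost e + (T1 + T2)).+1 Q.
Proof.
move=> h1 h2; case: (eqVneq (eval m e) 0) => h.
  have [t [m' [ex l Qm]]] := h2 h.
  exists (cost e + t).+1, m'; split=> //; first exact: ExecIfFalse.
  by rewrite ltnS leq_add2l (leq_trans l) ?leq_addl.
have [t [m' [ex l Qm]]] := h1 h.
exists (cost e + t).+1, m'; split=> //; first exact: ExecIfTrue.
by rewrite ltnS leq_add2l (leq_trans l) ?leq_addr.
Qed.

(** The guard evaluates to the number of rounds left, which yields both termination and the exact
    count. *)
Lemma runs_while (N T : nat) (J : nat -> memory -> Prop) e c m :
  (forall i m, i <= N -> J i m -> eval m e = N - i) ->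
  (forall i m, i < N -> J i m -> runs c m T (J i.+1)) ->
  J 0 m -> runs (While e c) m (N * (cost e + T).+1 + (cost e).+1) (J N).
Proof.
move=> he hc J0.
suff: forall k i m, i + k = N -> J i m ->
    runs (While e c) m (k * (cost e + T).+1 + (cost e).+1) (J N).
  by move=> /(_ N 0 m (add0n N) J0).
elim=> [|k IH] i {J0}m ik Ji.
  have iN : i = N by rewrite -ik addn0.
  exists (cost e).+1, m; split; [|by rewrite mul0n|by rewrite -iN].
  by apply: ExecWhileFalse; rewrite (he i m) ?iN ?subnn // -iN.
have iN : i < N by lia.
have [t1 [m1 [e1 l1 J1]]] := hc _ _ iN Ji.
have [|t2 [m2 [e2 l2 J2]]] := IH i.+1 m1 _ J1; first by lia.
exists (cost e + t1 + t2).+1, m2; split=> //; last by lia.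
by apply: ExecWhileTrue e1 e2; rewrite (he i m) //; lia.
Qed.

(** * An array language compiled to the machine *)

Inductive term : Type :=
  | TConst of nat
  | TD
  | TK
  | TVar of nat
  | TAdj of nat & nat
  | TArr of nat & nat & nat & nat & nat
  | TAdd of term & term
  | TSub of term & term
  | TIf of term & term & term
  | TSum of nat & term.

(* All arrays have four indices below [n].  [CSet a e] assigns all entries of [a]
   at once, the indices being the variables 0, 1, 2, 3 of [e].  Every loop has
   length [n], so that the running time is polynomial by construction. *)
Inductive command : Type :=
  | CSet of nat & term
  | CSeq of command & command
  | CLoop of command.

Definition env4 (X : Type) (i j k l : X) : nat -> X :=
  fun v => match v with 0 => i | 1 => j | 2 => k | _ => l end.

Definition upd (X : Type) (r : nat -> X) (v : nat) (i : X) : nat -> X :=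
  fun u => if u == v then i else r u.

Section Semantics.
Variables (n : nat) (w : memory).

Definition state := nat -> 'I_n -> 'I_n -> 'I_n -> 'I_n -> nat.

Fixpoint teval (s : state) (r : nat -> 'I_n) (e : term) : nat :=
  match e with
  | TConst c => c
  | TD => w 1
  | TK => w 2
  | TVar v => r v
  | TAdj u v => w (3 + (r u * n + r v))
  | TArr a i j k l => s a (r i) (r j) (r k) (r l)
  | TAdd e1 e2 => teval s r e1 + teval s r e2
  | TSub e1 e2 => teval s r e1 - teval s r e2
  | TIf e1 e2 e3 => if teval s r e1 != 0 then teval s r e2 else teval s r e3
  | TSum v e1 => \sum_(i < n) teval s (upd r v i) e1
  end.

Fixpoint crun (c : command) (s : state) : state :=
  match c with
  | CSet a e => fun b => if b == a then fun i j k l => teval s (env4 i j k l) e else s b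
  | CSeq c1 c2 => crun c2 (crun c1 s)
  | CLoop c1 => iter n (crun c1) s
  end.

End Semantics.

(** Cells 0, 1, 2 and the off-diagonal part of the adjacency matrix are never
    overwritten.  Cell 3, the entry (0, 0) of that matrix, holds an address [B]
    beyond the input; even offsets from [B] form a stack and odd ones hold the
    arrays.  A frame of the stack consists of a value and of a loop counter [i],
    stored as [i * n ^ t] for [t < 4], so that array addresses can be computed
    without multiplication. *)
Definition cellE (c : nat) : expr := Add (Read (Const 3)) (Const (2 * c)).
Definition rd (c : nat) : expr := Read (cellE c).
Definition wr (c : nat) (e : expr) : program := Write (cellE c) e.
(** Stack cells 0 to 4 hold the powers [n ^ 0] to [n ^ 4]; each frame then takes five cells, one
    value and four multiples of the counter. *)
Definition val (p : nat) : nat := 5 + 5 * p.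
Definition slot (p t : nat) : nat := (val p + t).+1.

Fixpoint mulc (a : nat) (e : expr) : expr :=
  if a is a'.+1 then Add e (mulc a' e) else Const 0.

Definition arrE (a i j k l : nat) : expr :=
  Add (Add (Read (Const 3)) (Const 1))
    (mulc 2 (Add (rd (slot i 0)) (Add (rd (slot j 1)) (Add (rd (slot k 2))
       (Add (rd (slot l 3)) (mulc a (rd 4))))))).

Definition reset (p : nat) : program :=
  Seq (Seq (wr (slot p 0) (Const 0)) (wr (slot p 1) (Const 0)))
      (Seq (wr (slot p 2) (Const 0)) (wr (slot p 3) (Const 0))).

Definition incr1 (p t : nat) : program := wr (slot p t) (Add (rd (slot p t)) (rd t)).

Definition incr (p : nat) : program :=
  Seq (Seq (incr1 p 0) (incr1 p 1)) (Seq (incr1 p 2) (incr1 p 3)).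

Definition for_ (p : nat) (c : program) : program :=
  Seq (reset p) (While (Sub (Read (Const 0)) (rd (slot p 0))) (Seq c (incr p))).

(** [f] sends a variable to the frame of its counter, and [p] is the first free frame. A sum uses
    both halves of frame [p]: the counter runs while the value cell accumulates. *)
Fixpoint compE (f : nat -> nat) (p : nat) (e : term) : program :=
  match e with
  | TConst c => wr (val p) (Const c)
  | TD => wr (val p) (Read (Const 1))
  | TK => wr (val p) (Read (Const 2))
  | TVar v => wr (val p) (rd (slot (f v) 0))
  | TAdj u v =>
      wr (val p) (Read (Add (Const 3) (Add (rd (slot (f u) 1)) (rd (slot (f v) 0)))))
  | TArr a i j k l => wr (val p) (Read (arrE a.+1 (f i) (f j) (f k) (f l)))
  | TAdd e1 e2 => Seq (compE f p e1) (Seq (compE f p.+1 e2)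
                    (wr (val p) (Add (rd (val p)) (rd (val p.+1)))))
  | TSub e1 e2 => Seq (compE f p e1) (Seq (compE f p.+1 e2)
                    (wr (val p) (Sub (rd (val p)) (rd (val p.+1)))))
  | TIf e1 e2 e3 =>
      Seq (compE f p e1) (If (rd (val p)) (compE f p e2) (compE f p e3))
  | TSum v e1 => Seq (wr (val p) (Const 0)) (for_ p (Seq (compE (upd f v p) p.+1 e1)
                    (wr (val p) (Add (rd (val p)) (rd (val p.+1))))))
  end.

Definition for4 (p : nat) (c : program) : program :=
  for_ p (for_ p.+1 (for_ p.+2 (for_ p.+3 c))).

Definition arr4 (a p : nat) : expr := arrE a p p.+1 p.+2 p.+3.

(* Array 0 of the machine buffers the new values of a simultaneous assignment. *)
Fixpoint compC (p : nat) (c : command) : program :=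
  match c with
  | CSet a e =>
      Seq (for4 p (Seq (compE (env4 p p.+1 p.+2 p.+3) p.+4 e)
                       (Write (arr4 0 p) (rd (val p.+4)))))
          (for4 p (Write (arr4 a.+1 p) (Read (arr4 0 p))))
  | CSeq c1 c2 => Seq (compC p c1) (compC p c2)
  | CLoop c1 => for_ p (compC p.+1 c1)
  end.

(** * Memory layout and what each program fragment preserves *)

Section Memory.
Variables (n B : nat) (w : memory).

Definition saddr (c : nat) : nat := B + 2 * c.
Definition aaddr (a i j k l : nat) : nat :=
  (B + 2 * (i + (j * n + (k * n ^ 2 + (l * n ^ 3 + a * n ^ 4))))).+1.

(* [h] is 5, except while the powers of [n] are being computed. *)
Record okh (h : nat) (m : memory) : Prop := Ok {
  ok_n : m 0 = n;
  ok_B : m 3 = B;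
  ok_lt : n * n + 3 < B;
  ok_low : forall x, x < B -> m x = w x;
  ok_pow : forall t, t < h -> m (saddr t) = n ^ t
}.

Definition ok : memory -> Prop := okh 5.

Definition slot_is (m : memory) (p i : nat) : Prop :=
  forall t, t < 4 -> m (saddr (slot p t)) = i * n ^ t.

Definition stackhigh (c x : nat) : Prop := exists2 c', c <= c' & x = saddr c'.

Definition same (c : nat) (m m' : memory) : Prop :=
  forall x, ~ stackhigh c x -> m' x = m x.

Lemma same_trans c m1 m2 m3 : same c m1 m2 -> same c m2 m3 -> same c m1 m3.
Proof. by move=> h h' x hx; rewrite h' ?h. Qed.

Lemma same_sub c c' m m' : c <= c' -> same c' m m' -> same c m m'.
Proof.
move=> cc h x hx; apply: h => -[c0 l e]; apply: hx; exists c0 => //.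
exact: leq_trans l.
Qed.

Lemma same_update c c' m v : c <= c' -> same c m (update m (saddr c') v).
Proof.
by move=> cc x hx; rewrite /update; case: eqP => // e; case: hx; exists c'.
Qed.

Lemma saddr_inj c c' : (saddr c == saddr c') = (c == c').
Proof. by rewrite /saddr eqn_add2l eqn_pmul2l. Qed.

Lemma low_stack c x : x < B -> ~ stackhigh c x.
Proof. by move=> h [c' _ e]; move: h; rewrite e /saddr; lia. Qed.

Lemma below_stack c c' : c' < c -> ~ stackhigh c (saddr c').
Proof. by move=> h [c0 l] /eqP; rewrite saddr_inj => /eqP e; lia. Qed.

Lemma arr_stack c a i j k l : ~ stackhigh c (aaddr a i j k l).
Proof. by move=> [c' _]; rewrite /saddr /aaddr; lia. Qed.

Lemma same_ok c m m' : 5 <= c -> same c m m' -> ok m -> ok m'.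
Proof.
move=> hc h [h0 h3 hB h1 h2].
have L x : x < B -> m' x = m x by move=> hx; rewrite h //; apply: low_stack.
split=> [|||x hx|t ht] //; try by rewrite L //; lia.
  by rewrite L ?h1.
by rewrite h ?h2 //; apply: below_stack; lia.
Qed.

Lemma same_slot c p m m' i : val p.+1 <= c -> same c m m' -> slot_is m p i -> slot_is m' p i.
Proof.
move=> hc h hs t ht; rewrite h ?hs //; apply: below_stack.
by rewrite /slot; move: hc; rewrite /val; lia.
Qed.

Lemma eval_cell h m c : okh h m -> eval m (cellE c) = saddr c.
Proof. by move=> hm; rewrite /= (ok_B hm). Qed.

Lemma eval_rd h m c : okh h m -> eval m (rd c) = m (saddr c).
Proof. by move=> hm; rewrite -(eval_cell c hm). Qed.

Lemma eval_mulc m a e : eval m (mulc a e) = a * eval m e.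
Proof. by elim: a => //= a ->; rewrite mulSn. Qed.

Lemma eval_arr m a p1 p2 p3 p4 i j k l : ok m ->
  slot_is m p1 i -> slot_is m p2 j -> slot_is m p3 k -> slot_is m p4 l ->
  eval m (arrE a p1 p2 p3 p4) = aaddr a i j k l.
Proof.
move=> h h1 h2 h3 h4; rewrite /arrE /aaddr.
have -> : forall e1 e2, eval m (Add e1 e2) = eval m e1 + eval m e2 by [].
rewrite eval_mulc.
have E : forall e1 e2, eval m (Add e1 e2) = eval m e1 + eval m e2 by [].
rewrite !E eval_mulc !(eval_rd _ h) h1 // h2 // h3 // h4 // (ok_pow h) //= (ok_B h).
by rewrite expn0 expn1 muln1; lia.
Qed.

Lemma aaddr_inj a (i j k l i' j' k' l' : 'I_n) b :
  aaddr a i j k l = aaddr b i' j' k' l' ->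
  [/\ a = b, i = i', j = j', k = k' & l = l'].
Proof.
have n0 : 0 < n by apply: leq_ltn_trans (ltn_ord i).
have D (x y x' y' : nat) : x < n -> x' < n -> x + y * n = x' + y' * n -> x = x' /\ y = y'.
  move=> hx hx' e; split.
    by move: (congr1 (modn^~ n) e); rewrite !(addnC _ (_ * n)) !modnMDl !modn_small.
  by move: (congr1 (divn^~ n) e); rewrite !(addnC _ (_ * n)) !divnMDl // !divn_small // !addn0.
move=> [] /addnI /eqP; rewrite eqn_pmul2l // => /eqP.
(* Horner form: [D] then strips one base-[n] digit at a time, the array number being the unbounded
   leading digit. *)
have R (x1 x2 x3 x4 x5 : nat) : x1 + (x2 * n + (x3 * n ^ 2 + (x4 * n ^ 3 + x5 * n ^ 4)))
    = x1 + (x2 + (x3 + (x4 + x5 * n) * n) * n) * n.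
  by rewrite !expnS expn0 muln1 !mulnDl -!mulnA.
rewrite !R => /D [] // e1 /D [] // e2 /D [] // e3 /D [] // e4 e5.
by split=> //; apply: val_inj.
Qed.

Lemma runs_wr h c e m (Q : memory -> Prop) : okh h m ->
  Q (update m (saddr c) (eval m e)) -> runs (wr c e) m (4 + cost e).+1 Q.
Proof. by move=> hm hQ; apply: runs_write; rewrite (eval_cell _ hm). Qed.

Lemma updateE m a v : update m a v a = v.
Proof. by rewrite /update eqxx. Qed.

Lemma update_neq m a v x : x != a -> update m a v x = m x.
Proof. by rewrite /update => /negPf ->. Qed.

Definition not_slot (p x : nat) : Prop := forall t, t < 4 -> x <> saddr (slot p t).

(** Finer than [same]: moving the counter of frame [p] must not disturb the value cell of that
    frame, where a partial sum is kept. *)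
Definition upto_slot p (m m' : memory) := forall x, not_slot p x -> m' x = m x.

Lemma upto_slot_ok p m m' : upto_slot p m m' -> ok m -> ok m'.
Proof.
move=> h [h0 h3 hB h1 h2].
have L x : x < B -> m' x = m x.
  by move=> hx; rewrite h // => t _ e; move: hx; rewrite e /saddr; lia.
split=> [|||x hx|t ht] //; try by rewrite L //; lia.
  by rewrite L ?h1.
rewrite h ?h2 // => t' _ /eqP; rewrite saddr_inj /slot /val; lia.
Qed.

Lemma runs_reset p m : ok m ->
  runs (reset p) m 24 (fun m' => upto_slot p m m' /\ slot_is m' p 0).
Proof.
move=> h; rewrite /reset.
have up t m1 v : t < 4 -> upto_slot p m m1 -> upto_slot p m (update m1 (saddr (slot p t)) v).
  by move=> ht h1 x hx; rewrite update_neq ?h1 //; apply/eqP/hx.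
have h0 : upto_slot p m m by [].
have W t m1 (Q : memory -> Prop) : ok m1 ->
  Q (update m1 (saddr (slot p t)) 0) -> runs (wr (slot p t) (Const 0)) m1 6 Q.
  by move=> hk; apply: (runs_wr hk).
apply: (@runs_seq _ _ _ 12 12); apply: (@runs_seq _ _ _ 6 6); apply: (W) => //.
set m1 := update _ _ _; have u1 : upto_slot p m m1 by apply: up.
apply: (W); first exact: upto_slot_ok u1 h.
set m2 := update _ _ _; have u2 : upto_slot p m m2 by apply: up.
apply: (@runs_seq _ _ _ 6 6); apply: (W); first exact: upto_slot_ok u2 h.
set m3 := update _ _ _; have u3 : upto_slot p m m3 by apply: up.
apply: (W); first exact: upto_slot_ok u3 h.
split; first exact: up.
move=> [|[|[|[|t]]]] // _; rewrite mul0n /m3 /m2 /m1 /update !saddr_inj !eqSS !eqn_add2l //.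
Qed.

Lemma runs_incr p i m : ok m -> slot_is m p i ->
  runs (incr p) m 64 (fun m' => upto_slot p m m' /\ slot_is m' p i.+1).
Proof.
move=> h hs; rewrite /incr.
pose J c m' := upto_slot p m m' /\
  forall t, t < 4 -> m' (saddr (slot p t)) = (if t < c then i.+1 else i) * n ^ t.
have W t m1 (Q : memory -> Prop) : t < 4 -> J t m1 ->
  (forall m2, J t.+1 m2 -> Q m2) -> runs (incr1 p t) m1 16 Q.
  move=> ht [u1 s1] hQ; have k1 := upto_slot_ok u1 h.
  apply: (runs_wr k1); apply: hQ.
  have E : forall e1 e2, eval m1 (Add e1 e2) = eval m1 e1 + eval m1 e2 by [].
  rewrite E !(eval_rd _ k1) s1 // ltnn (ok_pow k1); last by lia.
  split=> [x hx|t' ht']; first by rewrite update_neq ?u1 //; apply/eqP/hx.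
  rewrite /update saddr_inj eqSS eqn_add2l ltnS leq_eqVlt.
  case: eqP => [->|_] /=; first by rewrite mulSn addnC.
  by rewrite s1.
apply: (@runs_seq _ _ _ 32 32); apply: (@runs_seq _ _ _ 16 16); apply: (W 0) => // m1 J1.
apply: (W 1) => // m2 J2; apply: (@runs_seq _ _ _ 16 16).
apply: (W 2) => // m3 J3; apply: (W 3) => // m4 [u4 s4]; split=> // t ht.
by rewrite s4 // ht.
Qed.

Lemma runs_for p c T (J : nat -> memory -> Prop) m :
  (forall i m, J i m -> ok m) ->
  (forall i m m', J i m -> upto_slot p m m' -> J i m') ->
  (forall i m, i < n -> J i m -> slot_is m p i ->
     runs c m T (fun m' => J i.+1 m' /\ slot_is m' p i)) ->
  J 0 m -> runs (for_ p c) m (n * (T + 73) + 33) (J n).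
Proof.
move=> Jok Jup Jc J0.
(* The reset costs 24 and the failing guard 9; each round pays 9 for the guard and 64 for the
   increment. *)
have -> : n * (T + 73) + 33 = 24 + (n * (8 + (T + 64)).+1 + 9) by lia.
apply: runs_seq; apply: runs_weaken (runs_reset p (Jok _ _ J0)) _ _ => // m1 [u1 s1].
apply: runs_weaken (@runs_while n (T + 64) (fun i m => J i m /\ slot_is m p i)
  (Sub (Read (Const 0)) (rd (slot p 0))) _ m1 _ _ _) _ _ => //.
- move=> i m2 _ [Ji si]; have k2 := Jok _ _ Ji.
  have -> : forall e1 e2, eval m2 (Sub e1 e2) = eval m2 e1 - eval m2 e2 by [].
  by rewrite (eval_rd _ k2) si // muln1 /= (ok_n k2).
- move=> i m2 hi [Ji si]; apply: runs_seq; apply: runs_weaken (Jc _ _ hi Ji si) _ _ => //.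
  move=> m3 [J3 s3]; apply: runs_weaken (runs_incr (Jok _ _ J3) s3) _ _ => //.
  by move=> m4 [u4 s4]; split=> //; apply: Jup J3 u4.
- by split=> //; apply: Jup J0 u1.
- by move=> m' [].
Qed.

Definition arrays (m : memory) (s : state n) : Prop :=
  forall a (i j k l : 'I_n), m (aaddr a.+1 i j k l) = s a i j k l.

Lemma same_arrays c m m' s : same c m m' -> arrays m s -> arrays m' s.
Proof. by move=> h ha a i j k l; rewrite h ?ha //; apply: arr_stack. Qed.

Lemma upto_slot_same p m m' : upto_slot p m m' -> same (val p) m m'.
Proof.
move=> h x hx; apply: h => t _ e; apply: hx; exists (slot p t) => //.
by rewrite /slot /val; lia.
Qed.

Definition env_is (m : memory) (p : nat) (f : nat -> nat) (r : nat -> 'I_n) : Prop :=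
  forall v, f v < p /\ slot_is m (f v) (r v).

Lemma same_env c m m' p f r : val p <= c -> same c m m' -> env_is m p f r -> env_is m' p f r.
Proof.
move=> hc h he v; have [h1 h2] := he v; split=> //; apply: same_slot h h2.
by move: hc; rewrite /val; lia.
Qed.

End Memory.

(** * Correctness and cost of compiled terms *)

Lemma runs_for_poly (P : {poly nat}) : exists P' : {poly nat}, forall n,
  n * ((P.[n])%R + 73) + 33 = (P'.[n])%R.
Proof.
exists ('X * (P + (73%N)%:P) + (33%N)%:P)%R => n.
by rewrite !hornerD hornerM hornerD hornerX !hornerC.
Qed.

(** The polynomial is chosen before [n], the memory and the arrays: one bound serves all inputs. *)
Definition computes (f : nat -> nat) (p : nat) (c : program) (e : term) : Prop :=
  exists P : {poly nat}, forall n B w (s : state n) (r : nat -> 'I_n) m,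
  ok n B w m -> arrays B m s -> env_is B m p f r ->
  runs c m (P.[n])%R (fun m' =>
    same B (val p) m m' /\ m' (saddr B (val p)) = teval w s r e).

Lemma runs_leaf n B w m (p : nat) (E : expr) : ok n B w m ->
  runs (wr (val p) E) m (((4 + cost E).+1)%N%:P.[n])%R (fun m' =>
    same B (val p) m m' /\ m' (saddr B (val p)) = eval m E).
Proof.
move=> km; rewrite hornerC; apply: (runs_wr km).
by split; [exact: (same_update _ _ (leqnn _)) | rewrite updateE].
Qed.

Lemma computes_leaf f p e E :
  (forall n B w (s : state n) (r : nat -> 'I_n) m,
    ok n B w m -> arrays B m s -> env_is B m p f r ->
    eval m E = teval w s r e) ->
  computes f p (wr (val p) E) e.
Proof.
move=> H; exists (((4 + cost E).+1)%N%:P)%R => n B w s r m km am em.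
apply: runs_weaken (runs_leaf p E km) (leqnn _) _ => m' [sm ->].
by split=> //; exact: (H _ _ _ _ _ _ km am em).
Qed.

Lemma computes_binop f p e1 e2 e (op : expr -> expr -> expr) (fop : nat -> nat -> nat) :
  (forall m a b, eval m (op a b) = fop (eval m a) (eval m b)) ->
  (forall n w (s : state n) (r : nat -> 'I_n),
     teval w s r e = fop (teval w s r e1) (teval w s r e2)) ->
  computes f p (compE f p e1) e1 -> computes f p.+1 (compE f p.+1 e2) e2 ->
  computes f p (Seq (compE f p e1) (Seq (compE f p.+1 e2)
    (wr (val p) (op (rd (val p)) (rd (val p.+1)))))) e.
Proof.
move=> opE eE [P1 H1] [P2 H2].
pose c := (4 + cost (op (rd (val p)) (rd (val p.+1)))).+1.
exists (P1 + (P2 + c%:P))%R => n B w s r m km am em.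
rewrite !hornerD hornerC; apply: runs_seq.
apply: runs_weaken (H1 _ _ _ _ _ _ km am em) _ _ => // m1 [s1 v1].
have k1 : ok n B w m1 by apply: same_ok s1 km; rewrite /val; lia.
apply: runs_seq; apply: runs_weaken (H2 _ _ _ s r m1 k1 _ _) _ _ => //.
- exact: same_arrays s1 am.
- move=> v; have [e1' e2'] := same_env (leqnn _) s1 em v.
  by split=> //; apply: ltnW.
move=> m2 [s2 v2].
have k2 : ok n B w m2 by apply: same_ok s2 k1; rewrite /val; lia.
apply: (runs_wr k2); split.
  apply: same_trans s1 _; apply: same_trans (same_update _ _ (leqnn _)).
  by apply: same_sub s2; rewrite /val; lia.
rewrite updateE opE eE !(eval_rd _ k2) v2 s2 ?v1 //.
by apply: below_stack; rewrite /val; lia.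
Qed.

Lemma computes_sum f p v e : computes (upd f v p) p.+1 (compE (upd f v p) p.+1 e) e ->
  computes f p (compE f p (TSum v e)) (TSum v e).
Proof.
case=> P1 H1.
pose c := (4 + cost (Add (rd (val p)) (rd (val p.+1)))).+1.
have [P HP] := runs_for_poly (P1 + c%:P)%R.
exists (6%N%:P + P)%R => n B w s r m km am em.
rewrite hornerD hornerC -HP.
apply: runs_seq; apply: (runs_wr km).
set m0 := update _ _ _.
pose J i m' := same B (val p) m m' /\
  m' (saddr B (val p)) = \sum_(j < n | j < i) teval w s (upd r v j) e.
have Jok i m' : J i m' -> ok n B w m'.
  by case=> sm _; apply: same_ok sm km; rewrite /val; lia.
have J0 : J 0 m0.
  by split; [exact: (same_update _ _ (leqnn _)) | rewrite /m0 updateE big_pred0].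
apply: runs_weaken (runs_for (J := J) (T := ((P1 + c%:P).[n])%R) Jok _ _ J0) _ _ => //.
- move=> i m1 m2 [s1 v1] u; split.
    by apply: same_trans s1 _; apply: upto_slot_same.
  by rewrite u // => t _ /eqP; rewrite saddr_inj /slot; lia.
- move=> i m1 hi [s1 v1] sl; have k1 := Jok _ _ (conj s1 v1).
  rewrite hornerD hornerC; apply: runs_seq.
  apply: runs_weaken (H1 _ _ _ s (upd r v (Ordinal hi)) m1 k1 _ _) _ _ => //.
  + exact: same_arrays s1 am.
  + move=> u; rewrite /upd; case: eqP => // _.
    have [h1 h2] := em u; split; first exact: ltnW.
    by apply: same_slot s1 h2; rewrite /val; lia.
  move=> m2 [s2 v2].
  have k2 : ok n B w m2 by apply: same_ok s2 k1; rewrite /val; lia.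
  apply: (runs_wr k2); split; last first.
    move=> t ht; rewrite update_neq ?saddr_inj /slot; last by lia.
    by have := same_slot (leqnn _) s2 sl; apply.
  split.
    apply: same_trans s1 _; apply: same_trans (same_update _ _ (leqnn _)).
    by apply: same_sub s2; rewrite /val; lia.
  have -> : forall m a b, eval m (Add a b) = eval m a + eval m b by [].
  rewrite updateE !(eval_rd _ k2) v2 s2; last first.
    by apply: below_stack; rewrite /val; lia.
  rewrite v1 [RHS](bigD1 (Ordinal hi)) //= addnC; congr (_ + _).
  by apply: eq_bigl => j; rewrite -val_eqE /=; lia.
- by move=> m' [sm v']; split=> //; rewrite v'; apply: eq_bigl => j; rewrite ltn_ord.
Qed.

Lemma compE_correct e f p : computes f p (compE f p e) e.
Proof.
have rdS n B w m u t (i : nat) : ok n B w m -> slot_is n B m u i -> t < 4 ->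
    eval m (rd (slot u t)) = i * n ^ t.
  by move=> km sm lt; rewrite (eval_rd _ km) sm.
elim: e f p => [c|||v|u v|a i j k l|e1 IH1 e2 IH2|e1 IH1 e2 IH2|
    e1 IH1 e2 IH2 e3 IH3|v e1 IH1] f p.
- exact: computes_leaf.
- apply: computes_leaf => n B w s r m [_ _ hB h _] _ _ /=.
  by rewrite h //; lia.
- apply: computes_leaf => n B w s r m [_ _ hB h _] _ _ /=.
  by rewrite h //; lia.
- apply: computes_leaf => n B w s r m km _ em.
  by rewrite (rdS _ _ _ _ _ _ _ km (em v).2) // muln1.
- apply: computes_leaf => n B w s r m km _ em.
  have -> : forall e1 e2 e3, eval m (Read (Add e1 (Add e2 e3)))
    = m (eval m e1 + (eval m e2 + eval m e3)) by [].
  rewrite (rdS _ _ _ _ _ _ _ km (em u).2) // (rdS _ _ _ _ _ _ _ km (em v).2) //.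
  case: km => _ _ hB h _; rewrite h /= ?expn1 ?muln1 //.
  have := ltn_ord (r u); have := ltn_ord (r v) => h1 h2.
  have : r u * n + n <= n * n by rewrite -mulSnr leq_mul2r h2 orbT.
  by lia.
- apply: computes_leaf => n B w s r m km am em.
  have -> : forall E, eval m (Read E) = m (eval m E) by [].
  by rewrite (eval_arr _ km (em i).2 (em j).2 (em k).2 (em l).2) am.
- exact: (@computes_binop _ _ _ _ _ Add addn).
- exact: (@computes_binop _ _ _ _ _ Sub subn).
- have [P1 H1] := IH1 f p; have [P2 H2] := IH2 f p; have [P3 H3] := IH3 f p.
  exists (P1 + ((cost (rd (val p))).+1%:P + (P2 + P3)))%R => n B w s r m km am em.
  rewrite !hornerD hornerC; apply: runs_seq.
  apply: runs_weaken (H1 _ _ _ _ _ _ km am em) _ _ => // m1 [s1 v1].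
  have k1 : ok n B w m1 by apply: same_ok s1 km; rewrite /val; lia.
  have em1 := same_env (leqnn _) s1 em; have am1 := same_arrays s1 am.
  have R : eval m1 (rd (val p)) = teval w s r e1.
    by rewrite (eval_rd _ k1).
  apply: runs_if; rewrite R => h; rewrite [teval _ _ _ (TIf _ _ _)]/= h /=.
    apply: runs_weaken (H2 _ _ _ _ _ _ k1 am1 em1) _ _ => // m2 [s2 v2].
    by split=> //; apply: same_trans s1 s2.
  apply: runs_weaken (H3 _ _ _ _ _ _ k1 am1 em1) _ _ => // m2 [s2 v2].
  by split=> //; apply: same_trans s1 s2.
- exact: computes_sum.
Qed.

(** * Simultaneous array assignment and compiled commands *)

Section Fill.
Variables (n B : nat) (w : memory) (b : nat) (v : 'I_n -> 'I_n -> 'I_n -> 'I_n -> nat).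

Definition filled (m : memory) (i j k l : 'I_n) : Prop := m (aaddr n B b i j k l) = v i j k l.

(** Every entry is either untouched or final. In this form the relation composes, and a finished
    entry stays finished however the nested loops continue. *)
Definition fills (p : nat) (m m' : memory) : Prop :=
  (forall x, ~ stackhigh B (val p) x ->
     (forall i j k l : 'I_n, x <> aaddr n B b i j k l) -> m' x = m x) /\
  (forall i j k l : 'I_n,
     m' (aaddr n B b i j k l) = m (aaddr n B b i j k l) \/ filled m' i j k l).

Lemma fills_filled p m m' i j k l : fills p m m' -> filled m i j k l -> filled m' i j k l.
Proof. by move=> [_ h]; rewrite /filled; case: (h i j k l) => // ->. Qed.

Lemma fills_trans p m1 m2 m3 : fills p m1 m2 -> fills p m2 m3 -> fills p m1 m3.
Proof.
move=> h12 h23; split=> [x h1 h2|i j k l]; first by rewrite h23.1 ?h12.1.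
case: (h23.2 i j k l) => [e|]; last by right.
by case: (h12.2 i j k l) => [<-|]; [left | right; apply: fills_filled h23 _].
Qed.

Lemma same_fills p m m' : same B (val p) m m' -> fills p m m'.
Proof.
move=> h; split=> [x hx _|i j k l]; first exact: h.
by left; apply: h; apply: arr_stack.
Qed.

Lemma fills_sub p p' m m' : p <= p' -> fills p' m m' -> fills p m m'.
Proof.
move=> hp [h1 h2]; split=> // x hx; apply: h1 => -[c hc e]; apply: hx; exists c => //.
by apply: leq_trans hc; rewrite /val; lia.
Qed.

Lemma fills_low p m m' x : x < B -> fills p m m' -> m' x = m x.
Proof.
move=> hx [h _]; apply: h; first exact: low_stack.
by move=> i j k l e; move: hx; rewrite e /aaddr; lia.
Qed.

Lemma fills_saddr p m m' c : c < val p -> fills p m m' -> m' (saddr B c) = m (saddr B c).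
Proof.
move=> hc [h _]; apply: h; first exact: below_stack.
by move=> i j k l; rewrite /saddr /aaddr; lia.
Qed.

Lemma fills_ok p m m' : fills p m m' -> ok n B w m -> ok n B w m'.
Proof.
move=> h [h0 h3 hB h1 h2]; split=> [|||x hx|t ht] //.
- by rewrite (fills_low _ h) //; lia.
- by rewrite (fills_low _ h) //; lia.
- by rewrite (fills_low _ h) ?h1.
- by rewrite (fills_saddr _ h) ?h2 // /val; lia.
Qed.

Lemma fills_slot p q m m' i : q < p -> fills p m m' -> slot_is n B m q i -> slot_is n B m' q i.
Proof. by move=> qp h s t ht; rewrite (fills_saddr _ h) ?s // /slot /val; lia. Qed.

(** The loop invariant is that indices already treated stay treated, whence the stability demanded
    of [Q]. It is demanded for [fills 0], the coarsest case, so that all four nesting depths can use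
    it. *)
Lemma runs_for_fills p c T (Q : 'I_n -> memory -> Prop) m0 :
  (forall i m m', Q i m -> fills 0 m m' -> Q i m') -> ok n B w m0 ->
  (forall (i : 'I_n) m, fills p m0 m -> slot_is n B m p i ->
     runs c m T (fun m' => fills p.+1 m m' /\ Q i m')) ->
  runs (for_ p c) m0 (n * (T + 73) + 33) (fun m' => fills p m0 m' /\ forall i, Q i m').
Proof.
move=> QF k0 hc; pose J i m' := fills p m0 m' /\ forall j : 'I_n, j < i -> Q j m'.
apply: (@runs_weaken _ _ _ _ (J n)); [|exact: leqnn|]; last first.
  by move=> m' [h1 h2]; split=> // i; apply: h2.
apply: (@runs_for n B w).
- by move=> i m [h _]; apply: fills_ok h k0.
- move=> i m m' [h1 h2] /upto_slot_same /same_fills h; split.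
    exact: fills_trans h1 h.
  by move=> j hj; apply: QF (h2 j hj) _; apply: fills_sub h.
- move=> i m hi [h1 h2] s.
  apply: runs_weaken (hc (Ordinal hi) m h1 s) (leqnn _) _ => m' [h3 h4].
  split; last exact: fills_slot h3 s.
  split; first by apply: fills_trans h1 _; apply: fills_sub h3.
  move=> j; rewrite ltnS leq_eqVlt => /orP[/eqP e|hj].
    by rewrite (_ : j = Ordinal hi) //; apply: val_inj.
  by apply: QF (h2 j hj) _; apply: fills_sub h3.
- by split=> //; apply: same_fills.
Qed.

Lemma runs_for4 p c T m0 : ok n B w m0 ->
  (forall (i j k l : 'I_n) m, fills p m0 m -> slot_is n B m p i -> slot_is n B m p.+1 j ->
     slot_is n B m p.+2 k -> slot_is n B m p.+3 l ->
     runs c m T (fun m' => fills p.+4 m m' /\ filled m' i j k l)) ->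
  runs (for4 p c) m0 (iter 4 (fun T => n * (T + 73) + 33) T)
    (fun m' => fills p m0 m' /\ forall i j k l, filled m' i j k l).
Proof.
move=> k0 hc; apply: runs_for_fills => // [i m m' h hm j k l|i m1 f1 s1].
  exact: fills_filled hm (h j k l).
apply: runs_for_fills => [j m m' h hm k l| |j m2 f2 s2].
- exact: fills_filled hm (h k l).
- exact: fills_ok f1 k0.
have f02 : fills p m0 m2 by apply: fills_trans f1 _; apply: fills_sub f2.
apply: runs_for_fills => [k m m' h hm l| |k m3 f3 s3].
- exact: fills_filled hm (h l).
- exact: fills_ok f02 k0.
have f03 : fills p m0 m3 by apply: fills_trans f02 _; apply: fills_sub f3; lia.
apply: runs_for_fills => [l m m' h hm| |l m4 f4 s4].
- exact: fills_filled hm h.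
- exact: fills_ok f03 k0.
have f04 : fills p m0 m4 by apply: fills_trans f03 _; apply: fills_sub f4; lia.
apply: hc => //.
- by apply: fills_slot f4 _; [lia | apply: fills_slot f3 _; [lia | apply: fills_slot f2 _]].
- by apply: fills_slot f4 _; [lia | apply: fills_slot f3 _].
- by apply: fills_slot f4 _.
Qed.

End Fill.

(** The clause on cells below [val p] keeps the counters of enclosing loops intact. *)
Definition commands_run (p : nat) (c : command) : Prop :=
  exists P : {poly nat}, forall n B w (s : state n) m,
  ok n B w m -> arrays B m s ->
  runs (compC p c) m (P.[n])%R (fun m' =>
    [/\ ok n B w m', arrays B m' (crun w c s) &
        forall x, x < val p -> m' (saddr B x) = m (saddr B x)]).

Lemma runs_for_poly4 (P : {poly nat}) : exists P' : {poly nat}, forall n,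
  iter 4 (fun T => n * (T + 73) + 33) (P.[n])%R = (P'.[n])%R.
Proof.
have [P1 h1] := runs_for_poly P; have [P2 h2] := runs_for_poly P1.
have [P3 h3] := runs_for_poly P2; have [P4 h4] := runs_for_poly P3.
by exists P4 => n; rewrite /= h1 h2 h3 h4.
Qed.

Lemma set_correct a e p : commands_run p (CSet a e).
Proof.
have [P1 H1] := compE_correct e (env4 p p.+1 p.+2 p.+3) p.+4.
pose c1 := (cost (arr4 0 p) + cost (rd (val p.+4))).+1.
pose c2 := (cost (arr4 a.+1 p) + cost (Read (arr4 0 p))).+1.
have [P3 H3] := runs_for_poly4 (P1 + c1%:P)%R; have [P4 H4] := runs_for_poly4 (c2%:P)%R.
exists (P3 + P4)%R => n B w s m km am; rewrite hornerD -H3 -H4 hornerD !hornerC.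
pose v i j k l := teval w s (env4 i j k l) e.
apply: runs_seq.
apply: runs_weaken (runs_for4 (b := 0) (v := v) km _) (leqnn _) _.
  move=> i j k l m1 f1 s1 s2 s3 s4; have k1 := fills_ok f1 km.
  have am1 : arrays B m1 s.
    move=> a' i' j' k' l'; rewrite f1.1 ?am //; first exact: arr_stack.
    by move=> i2 j2 k2 l2 /aaddr_inj [].
  have em1 : env_is B m1 p.+4 (env4 p p.+1 p.+2 p.+3) (env4 i j k l).
    by move=> [|[|[|u]]]; split=> //=; lia.
  apply: runs_seq; apply: runs_weaken (H1 _ _ _ _ _ _ k1 am1 em1) (leqnn _) _ => m2 [s12 v2].
  have f2 := @same_fills n B 0 v _ _ _ s12; have k2 := fills_ok f2 k1.
  have e2 : eval m2 (arr4 0 p) = aaddr n B 0 i j k l.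
    by apply: (eval_arr _ k2); apply: fills_slot f2 _ => //; lia.
  apply: runs_write; rewrite e2 (eval_rd _ k2) v2; split; last by rewrite /filled updateE.
  apply: fills_trans f2 _; split=> [x _ hx|i' j' k' l'].
    by rewrite update_neq //; apply/eqP/hx.
  rewrite /filled /update; case: eqP => [/aaddr_inj [_ -> -> -> ->]|_]; [by right | by left].
move=> m1 [f1 v1]; have k1 := fills_ok f1 km.
have am1 : arrays B m1 s.
  move=> a' i' j' k' l'; rewrite f1.1 ?am //; first exact: arr_stack.
  by move=> i2 j2 k2 l2 /aaddr_inj [].
apply: runs_weaken (runs_for4 (b := a.+1) (v := v) (T := c2) k1 _) (leqnn _) _.
  move=> i j k l m2 f2 s1 s2 s3 s4; have k2 := fills_ok f2 k1.
  have e2 b' : eval m2 (arr4 b' p) = aaddr n B b' i j k l by apply: (eval_arr _ k2).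
  apply: runs_write; rewrite e2.
  have -> : eval m2 (Read (arr4 0 p)) = v i j k l.
    have -> : forall E, eval m2 (Read E) = m2 (eval m2 E) by [].
    rewrite e2 f2.1; [exact: v1| |]; first exact: arr_stack.
    by move=> i2 j2 k3 l2 /aaddr_inj [].
  split; last by rewrite /filled updateE.
  split=> [x _ hx|i' j' k' l'].
    by rewrite update_neq //; apply/eqP/hx.
  rewrite /filled /update; case: eqP => [/aaddr_inj [_ -> -> -> ->]|_]; [by right | by left].
move=> m2 [f2 v2]; split.
- exact: fills_ok f2 k1.
- move=> a' i j k l; rewrite /=; case: eqP => [->|ne]; first exact: v2.
  rewrite f2.1 ?am1 //; first exact: arr_stack.
  by move=> i2 j2 k3 l2 /aaddr_inj [] [].
- by move=> x hx; rewrite (fills_saddr hx f2) (fills_saddr hx f1).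
Qed.

Lemma compC_correct c p : commands_run p c.
Proof.
elim: c p => [a e|c1 IH1 c2 IH2|c1 IH1] p; first exact: set_correct.
  have [P1 H1] := IH1 p; have [P2 H2] := IH2 p.
  exists (P1 + P2)%R => n B w s m km am; rewrite hornerD; apply: runs_seq.
  apply: runs_weaken (H1 _ _ _ _ _ km am) (leqnn _) _ => m1 [k1 am1 l1].
  apply: runs_weaken (H2 _ _ _ _ _ k1 am1) (leqnn _) _ => m2 [k2 am2 l2].
  by split=> // x hx; rewrite l2 ?l1.
have [P1 H1] := IH1 p.+1; have [P2 H2] := runs_for_poly P1.
exists P2 => n B w s m km am; rewrite -H2.
pose J i m' := [/\ ok n B w m', arrays B m' (iter i (crun w c1) s) &
  forall x, x < val p -> m' (saddr B x) = m (saddr B x)].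
apply: (runs_for (B := B) (w := w) (J := J)) => [i m1 []|i m1 m2 [k1 am1 l1] u|i m1 hi [k1 am1 l1] s1|] //.
  have sm := upto_slot_same u; split.
  - exact: upto_slot_ok u k1.
  - exact: same_arrays sm am1.
  - by move=> x hx; rewrite sm ?l1 //; apply: below_stack.
apply: runs_weaken (H1 _ _ _ _ _ k1 am1) (leqnn _) _ => m2 [k2 am2 l2]; split.
  by split=> // x hx; rewrite l2 ?l1 // (leq_trans hx) // /val; lia.
by move=> t ht; rewrite l2 ?s1 // /slot /val; lia.
Qed.

(** * Initialisation of the base address and of the powers of [n] *)

(* The entry (1, 1) of the adjacency matrix, or a cell beyond the input when [n = 1]. *)
Definition diagE : expr := Add (Read (Const 0)) (Const 4).

(** Squares [n] by adding it [n] times to cell 3, which starts at 0 as a diagonal entry. The extra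
    [n + 10] puts the base above the input and above the scratch cell [n + 4]. *)
Definition init_base : program :=
  Seq (While (Sub (Read (Const 0)) (Read diagE))
        (Seq (Write (Const 3) (Add (Read (Const 3)) (Read (Const 0))))
             (Write diagE (Add (Read diagE) (Const 1)))))
      (Write (Const 3) (Add (Read (Const 3)) (Add (Read (Const 0)) (Const 10)))).

(** Again a product by repeated addition; the loop counter is the value cell of frame 0, just above
    the five powers. *)
Definition init_pow (t : nat) : program :=
  Seq (wr t.+1 (Const 0)) (Seq (wr (val 0) (Const 0))
    (While (Sub (Read (Const 0)) (rd (val 0)))
      (Seq (wr t.+1 (Add (rd t.+1) (rd t)))
           (wr (val 0) (Add (rd (val 0)) (Const 1)))))).

Definition init : program :=
  Seq init_base (Seq (wr 0 (Const 1))
    (Seq (Seq (init_pow 0) (init_pow 1)) (Seq (init_pow 2) (init_pow 3)))).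

Lemma runs_init_base : exists P : {poly nat}, forall n m, 0 < n ->
  m 0 = n -> m 3 = 0 -> m (n + 4) = 0 ->
  runs init_base m (P.[n])%R (fun m' => m' 3 = n * n + n + 10 /\
    forall x, x <> 3 -> x <> n + 4 -> m' x = m x).
Proof.
pose c1 := (cost (Sub (Read (Const 0)) (Read diagE))).+1.
pose c2 := (cost (Const 3) + cost (Add (Read (Const 3)) (Read (Const 0)))).+1.
pose c3 := (cost diagE + cost (Add (Read diagE) (Const 1))).+1.
pose c4 := (cost (Const 3) +
  cost (Add (Read (Const 3)) (Add (Read (Const 0)) (Const 10)))).+1.
exists ('X * ((c1 + (c2 + c3))%N)%:P + (c1 + c4)%N%:P)%R => n m n0 m0 m3 m4.
rewrite hornerD hornerM hornerX !hornerC.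
pose J i m' := [/\ m' 3 = i * n, m' (n + 4) = i &
  forall x, x <> 3 -> x <> n + 4 -> m' x = m x].
have J0 i m' : J i m' -> m' 0 = n by move=> [_ _ h]; rewrite h //; lia.
have D i m' : J i m' -> eval m' diagE = n + 4 by move=> h; rewrite /= (J0 i).
have -> : (n * (c1 + (c2 + c3)) + (c1 + c4))%R = n * (c1 + (c2 + c3)) + c1 + c4.
  by rewrite -addnA.
apply: runs_seq; apply: runs_weaken (@runs_while n (c2 + c3) J _ _ m _ _ _) _ _.
- move=> i m1 _ h; have -> : forall a b, eval m1 (Sub (Read a) (Read b)) =
    m1 (eval m1 a) - m1 (eval m1 b) by [].
  by rewrite (D i) //=; case: (h) => _ -> _; rewrite (J0 i).
- move=> i m1 hi h; have e0 := J0 _ _ h; case: (h) => e3 e4 ex.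
  apply: runs_seq; apply: runs_write; rewrite /= e3 e0.
  set m2 := update _ _ _.
  have d2 : eval m2 diagE = n + 4 by rewrite /= /m2 update_neq // e0.
  apply: runs_write; rewrite d2.
  have -> : eval m2 (Add (Read diagE) (Const 1)) = i.+1.
    have -> : forall a, eval m2 (Add (Read a) (Const 1)) = m2 (eval m2 a) + 1 by [].
    by rewrite d2 /m2 update_neq ?e4 ?addn1 //; lia.
  split.
  + by rewrite update_neq /m2 ?updateE ?mulSnr //; lia.
  + by rewrite updateE.
  + move=> x /eqP x3 /eqP x4; rewrite /m2 !update_neq //.
    by apply: ex; apply/eqP.
- by split; rewrite ?m3 ?m4 ?mul0n.
- by rewrite /c1; lia.
move=> m1 h; have e0 := J0 _ _ h; case: (h) => e3 e4 ex.
apply: runs_write; rewrite /= e3 e0; split; first by rewrite updateE; lia.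
by move=> x /eqP x3 /eqP x4; rewrite update_neq //; apply: ex; apply/eqP.
Qed.

Lemma runs_init_pow t : exists P : {poly nat}, forall n B w m, t < 4 -> okh n B w t.+1 m ->
  runs (init_pow t) m (P.[n])%R (okh n B w t.+2).
Proof.
pose c1 := (cost (Sub (Read (Const 0)) (rd (val 0)))).+1.
pose c2 := (4 + cost (Add (rd t.+1) (rd t))).+1.
pose c3 := (4 + cost (Add (rd (val 0)) (Const 1))).+1.
exists ('X * ((c1 + (c2 + c3))%N)%:P + (c1 + 12)%N%:P)%R => n B w m t4 km.
rewrite hornerD hornerM hornerX !hornerC.
have -> : (n * (c1 + (c2 + c3)) + (c1 + 12)%N)%R = 6 + (6 + (n * (c1 + (c2 + c3)) + c1)).
  by rewrite /GRing.add /= /GRing.mul /=; lia.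
pose J i m' := [/\ okh n B w t.+1 m', m' (saddr B t.+1) = i * n ^ t & m' (saddr B (val 0)) = i].
have up c v m1 : t < c -> okh n B w t.+1 m1 -> okh n B w t.+1 (update m1 (saddr B c) v).
  move=> hc [h0 h3 hB h1 h2].
  have L x : x < B -> update m1 (saddr B c) v x = m1 x.
    by move=> hx; rewrite update_neq //; apply/eqP; rewrite /saddr; lia.
  split=> [|||x hx|t' ht] //; [by rewrite L //; lia|by rewrite L //; lia|by rewrite L ?h1|].
  by rewrite update_neq ?h2 // saddr_inj; lia.
apply: runs_seq; apply: (runs_wr km); rewrite [eval _ _]/=.
have k1 := up t.+1 0 m (ltnSn t) km.
apply: runs_seq; apply: (runs_wr k1); rewrite [eval _ _]/=.
have k2 : okh n B w t.+1 (update (update m (saddr B t.+1) 0) (saddr B (val 0)) 0).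
  by apply: up k1; rewrite /val; lia.
set m2 := update _ _ _.
apply: runs_weaken (@runs_while n (c2 + c3) J _ _ m2 _ _ _) (leqnn _) _.
- move=> i m3 _ [k3 _ e3].
  have -> : forall b, eval m3 (Sub (Read (Const 0)) b) = m3 0 - eval m3 b by [].
  by rewrite (eval_rd _ k3) e3 (ok_n k3).
- move=> i m3 hi [k3 e1 e5].
  have E m' a b : eval m' (Add a b) = eval m' a + eval m' b by [].
  apply: runs_seq; apply: (runs_wr k3); rewrite E !(eval_rd _ k3) e1 (ok_pow k3) //.
  have k4 := up t.+1 (i * n ^ t + n ^ t) m3 (ltnSn t) k3; set m4 := update _ _ _ in k4 *.
  apply: (runs_wr k4); rewrite E !(eval_rd _ k4); split.
  + by apply: up => //; rewrite /val; lia.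
  + by rewrite update_neq ?saddr_inj /m4 ?updateE 1?mulSnr // /val; lia.
  + by rewrite updateE /m4 update_neq ?e5 /= ?addn1 // saddr_inj /val; lia.
- split; first exact: k2.
  + by rewrite mul0n /m2 update_neq ?updateE // saddr_inj /val; lia.
  + by rewrite /m2 updateE.
move=> m3 [[h0 h3 hB h1 h2] e1 _]; split=> // t'.
by rewrite ltnS leq_eqVlt => /orP[/eqP ->|]; [rewrite e1 expnS|apply: h2].
Qed.

Lemma runs_init : exists P : {poly nat}, forall n m, 0 < n ->
  m 0 = n -> m 3 = 0 -> m (n + 4) = 0 ->
  runs init m (P.[n])%R (fun m' => exists2 B, n * n + 3 < B & exists w, ok n B w m' /\
    forall x, x < B -> x <> 3 -> x <> n + 4 -> w x = m x).
Proof.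
have [Pb Hb] := runs_init_base.
have [P0 H0] := runs_init_pow 0; have [P1 H1] := runs_init_pow 1.
have [P2 H2] := runs_init_pow 2; have [P3 H3] := runs_init_pow 3.
exists (Pb + (6%N%:P + ((P0 + P1) + (P2 + P3))))%R => n m n0 m0 m3 m4.
rewrite !hornerD hornerC; apply: runs_seq.
apply: runs_weaken (Hb n m n0 m0 m3 m4) (leqnn _) _ => m1 [e3 ex].
set B := n * n + n + 10 in e3.
have BB : n * n + 3 < B by rewrite /B; lia.
have k0 : okh n B m1 0 m1 by split=> //; rewrite ex //; lia.
apply: runs_seq; apply: (runs_wr k0); rewrite [eval _ _]/=.
have k1 : okh n B m1 1 (update m1 (saddr B 0) 1).
  have L x : x < B -> update m1 (saddr B 0) 1 x = m1 x.
    by move=> hx; rewrite update_neq //; apply/eqP; rewrite /saddr; lia.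
  case: k0 => h0 h3 hB h1 h2.
  split=> [|||x hx|[|t] //]; [by rewrite L //; lia|by rewrite L //; lia|by []|by rewrite L|].
  by rewrite updateE.
apply: runs_seq; apply: runs_seq; apply: runs_weaken (H0 _ _ _ _ _ k1) (leqnn _) _ => // m2 k2.
apply: runs_weaken (H1 _ _ _ _ _ k2) (leqnn _) _ => // m5 k5.
apply: runs_seq; apply: runs_weaken (H2 _ _ _ _ _ k5) (leqnn _) _ => // m6 k6.
apply: runs_weaken (H3 _ _ _ _ _ k6) (leqnn _) _ => // m7 k7.
by exists B => //; exists m1; split=> // x _; apply: ex.
Qed.

(** * From array programs to polynomial-time decidability *)

(** Coefficients are natural numbers, so a bound in [n] is also a bound in the input length. *)
Lemma horner_nat_le (P : {poly nat}) a b : a <= b -> (P.[a] <= P.[b])%N%R.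
Proof.
move=> ab; rewrite /horner; elim: (P : seq nat) => //= x s IH.
by rewrite /GRing.add /GRing.mul /= leq_add2r leq_mul.
Qed.

Lemma size_le_input_length s : size s <= input_length s.
Proof. by rewrite /input_length -sum1_size leq_sum. Qed.

Lemma nth_encode_instance (x : instance) (i j : 'I_(nvert x)) :
  nth 0 (encode_instance x) (3 + (i * nvert x + j)) = adj (graph x) i j.
Proof.
rewrite /encode_instance [nth _ _ _]/=.
have -> : [seq nat_of_bool (adj (graph x) i j)
    | i <- enum 'I_(nvert x), j <- enum 'I_(nvert x)] =
  flatten [seq [seq nat_of_bool (adj (graph x) i j) | j <- enum 'I_(nvert x)]
    | i <- enum 'I_(nvert x)] by [].
set F := fun i => [seq nat_of_bool (adj (graph x) i j) | j <- enum 'I_(nvert x)].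
have szF k : size (F k) = nvert x by rewrite size_map size_enum_ord.
have gen (s : seq 'I_(nvert x)) k (y : nat) : k < size s -> y < nvert x ->
    nth 0 (flatten [seq F i | i <- s]) (k * nvert x + y) = nth 0 (F (nth i s k)) y.
  elim: s k => //= a s IH [|k] hk hy; rewrite nth_cat szF.
    by rewrite mul0n add0n hy.
  rewrite mulSn -addnA ltnNge leq_addr /= addKn; exact: IH.
rewrite gen ?size_enum_ord // nth_ord_enum (nth_map i) ?size_enum_ord //.
by rewrite nth_ord_enum.
Qed.

(* The diagonal is not specified because cells of it are used as scratch space. *)
Definition input_of (x : instance) (w : memory) : Prop :=
  [/\ w 1 = dval x, w 2 = kval x &
      forall i j : 'I_(nvert x), i != j -> w (3 + (i * nvert x + j)) = adj (graph x) i j].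

(** For [n = 0] no index environment exists; the program then does nothing and cell 0, holding [n],
    already reads as the answer no. Otherwise [e] is evaluated with all its variables pointing to
    frame 0, whose counter has been reset. *)
Lemma array_program_decides (c : command) (e : term) (promise yes : instance -> Prop) :
  (forall x, promise x -> nvert x = 0 -> ~ yes x) ->
  (forall x, promise x -> forall w (s : state (nvert x)) (r : nat -> 'I_(nvert x)),
     input_of x w -> let v := teval w (crun w c s) r e in
     (v = 1 /\ yes x) \/ (v = 0 /\ ~ yes x)) ->
  poly_time_decidable encode_instance promise yes.
Proof.
move=> H0 H1; have [Pi Hi] := runs_init; have [Pc Hc] := compC_correct c 0.
have [Pe He] := compE_correct e (fun _ => 0) 1.
pose c5 := (cost (Const 0) + cost (rd (val 1))).+1.
exists (If (Read (Const 0))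
  (Seq init (Seq (compC 0 c) (Seq (reset 0)
    (Seq (compE (fun _ => 0) 1 e) (Write (Const 0) (rd (val 1))))))) Skip).
pose P := (Pi + (Pc + (24%N%:P + (Pe + c5%:P))))%R.
exists (P + 4%N%:P)%R => x px; set m := load _.
have nx : nvert x <= input_length (encode_instance x).
  apply: leq_trans (size_le_input_length _).
  rewrite /encode_instance /= size_allpairs size_enum_ord.
  rewrite !(leq_trans _ (leqnSn _)) //.
  by case: (nvert x) => // k; rewrite mulSn leq_addr.
have m0 : m 0 = nvert x by [].
suff [t [m' [ex le an]]] : runs (If (Read (Const 0))
  (Seq init (Seq (compC 0 c) (Seq (reset 0)
    (Seq (compE (fun _ => 0) 1 e) (Write (Const 0) (rd (val 1))))))) Skip) m
    ((P + 4%N%:P).[nvert x])%R (fun m => (m 0 = 1 /\ yes x) \/ (m 0 = 0 /\ ~ yes x)).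
  by exists t, m'; split=> //; apply: leq_trans le _; apply: horner_nat_le.
have -> : ((P + 4%N%:P).[nvert x])%R = (2 + ((P.[nvert x])%R + 1)).+1.
  by rewrite hornerD hornerC /GRing.add /=; lia.
apply: runs_if => /= [n0|n0]; last first.
  by apply: runs_skip; right; split=> //; apply: H0 => //; rewrite -m0.
rewrite m0 -lt0n in n0; rewrite /P !hornerD !hornerC; apply: runs_seq.
have i0 : 'I_(nvert x) := Ordinal n0.
have m3 : m 3 = 0.
  have := nth_encode_instance (Ordinal n0) (Ordinal n0).
  by rewrite mul0n addn0 adj_irr.
(* This cell counts the rounds of [init_base], so it must start at 0: beyond the input it has the
   default value, and otherwise it is diagonal. *)
have m4 : m (nvert x + 4) = 0.
  case: (ltnP 1 (nvert x)) => n1; last first.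
    rewrite /m /load nth_default // /encode_instance /= size_allpairs size_enum_ord.
    by move: n0 n1; case: (nvert x) => [|[]].
  have e4 := nth_encode_instance (Ordinal n1) (Ordinal n1); rewrite adj_irr in e4.
  by rewrite (_ : nvert x + 4 = 3 + (Ordinal n1 * nvert x + Ordinal n1)) //=; lia.
apply: runs_weaken (Hi _ _ n0 m0 m3 m4) (leqnn _) _ => m1 [B hB [w [k1 lw]]].
have iw : input_of x w.
  have n0' := n0; split; try by rewrite lw //; lia.
  move=> i j ij; rewrite lw; first exact: nth_encode_instance.
  - have hi := ltn_ord i; have hj := ltn_ord j.
    have : i * nvert x + nvert x <= nvert x * nvert x by rewrite -mulSnr leq_mul2r hi orbT.
    by lia.
  - move=> e0; case/negP: ij; rewrite -val_eqE /=.
    have /eqP : i * nvert x + j = 0 by lia.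
    by rewrite addn_eq0 muln_eq0 (gtn_eqF n0) orbF => /andP[/eqP -> /eqP ->].
  - have hi := ltn_ord i; have hj := ltn_ord j; move=> e0; case/negP: ij; rewrite -val_eqE /=.
    have e1 : i * nvert x + j = nvert x + 1 by lia.
    move: hi e1; case: (nat_of_ord i) => [|[|k]]; rewrite ?mulSn ?mul0n; lia.
pose s : state (nvert x) := fun a i j k l => m1 (aaddr (nvert x) B a.+1 i j k l).
have am : arrays B m1 s by [].
apply: runs_seq; apply: runs_weaken (Hc _ _ _ _ _ k1 am) (leqnn _) _ => m2 [k2 am2 _].
apply: runs_seq; apply: runs_weaken (runs_reset 0 k2) (leqnn _) _ => m5 [u5 s5].
have k5 := upto_slot_ok u5 k2; have am5 := same_arrays (upto_slot_same u5) am2.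
have em5 : env_is B m5 1 (fun _ => 0) (fun _ => Ordinal n0) by move=> v; split.
apply: runs_seq; apply: runs_weaken (He _ _ _ _ _ _ k5 am5 em5) (leqnn _) _ => m6 [s6 v6].
have k6 : ok (nvert x) B w m6 by apply: same_ok s6 k5.
apply: runs_write; rewrite (eval_rd _ k6) v6 updateE.
exact: H1.
Qed.

(** * Transitive orientation *)

Section TransitiveOrientation.
Variable T : finType.
Implicit Types (e F : rel T) (A B : {set T * T}).

Definition torient e F : Prop :=
  [/\ forall x y, e x y = F x y || F y x, forall x y, F x y -> ~~ F y x & transitive F].

Lemma torient_sym e F : torient e F -> symmetric e.
Proof. by case=> h _ _ x y; rewrite !h orbC. Qed.

Lemma torient_irr e F : torient e F -> irreflexive e.
Proof. by case=> h ha _ x; rewrite h orbb; apply/negP => f; move: (ha _ _ f); rewrite f. Qed.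

Lemma torient_rev e F : torient e F -> torient e (fun x y => F y x).
Proof.
case=> h ha ht; split=> [x y|x y|y x z] //; first by rewrite h orbC.
  exact: ha.
by move=> h1 h2; apply: ht h1.
Qed.

(** Implication classes of Gallai and Golumbic: whenever [a b] and [a b'] are
    edges while [b b'] is not, a transitive orientation puts [a] on the same
    side of both edges. *)
Definition gamma_step e A : {set T * T} :=
  [set p | e p.1 p.2 && [exists z, ((p.1, z) \in A) && ~~ e z p.2
                                || ((z, p.2) \in A) && ~~ e z p.1]].

(** Connectedness is phrased as an invariance principle: what is preserved by each elementary
    forcing is constant on the class. All structural facts below are instances with a suitable
    [P]. *)
Record implication_class e A : Prop := ImplicationClass {
  class_sub a b : (a, b) \in A -> e a b;
  class_r a b b' : (a, b) \in A -> e a b' -> ~~ e b b' -> (a, b') \in A;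
  class_l a a' b : (a, b) \in A -> e a' b -> ~~ e a a' -> (a', b) \in A;
  class_connected (P : rel T) :
    (forall a b b', (a, b) \in A -> (a, b') \in A -> ~~ e b b' -> P a b = P a b') ->
    (forall a a' b, (a, b) \in A -> (a', b) \in A -> ~~ e a a' -> P a b = P a' b) ->
    forall a b c d, (a, b) \in A -> (c, d) \in A -> P a b = P c d
}.

Lemma gamma_step_mono e A B : A \subset B -> gamma_step e A \subset gamma_step e B.
Proof.
move=> /subsetP AB; apply/subsetP => p; rewrite !inE => /andP[-> /=] /existsP[z hz].
by apply/existsP; exists z; case/orP: hz => /andP[/AB -> ->] //; rewrite orbT.
Qed.

Definition gamma_closure e A : {set T * T} := fixset (fun B => A :|: gamma_step e B).

Let Fm e A : {homo (fun B => A :|: gamma_step e B) : B C / B \subset C}.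
Proof. by move=> B C h; apply: setUS; apply: gamma_step_mono. Qed.

Lemma gamma_closureE e A : gamma_closure e A = A :|: gamma_step e (gamma_closure e A).
Proof. by rewrite {1}/gamma_closure -(fixsetK (@Fm e A)). Qed.

Lemma gamma_closure_class e u v : symmetric e -> e u v ->
  implication_class e (gamma_closure e [set (u, v)]).
Proof.
move=> es euv; set A := gamma_closure _ _.
have AF : A = [set (u, v)] :|: gamma_step e A by exact: gamma_closureE.
have uvA : (u, v) \in A by rewrite AF !inE eqxx.
have Asub a b : (a, b) \in A -> e a b.
  by rewrite AF !inE => /orP[/eqP[-> ->]|/andP[]].
split=> // [a b b' ab ab' bb'|a a' b ab ab' aa'|P Pr Pl a b c d].
- by rewrite AF !inE ab' /=; apply/orP; right; apply/existsP; exists b; rewrite ab bb'.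
- by rewrite AF !inE ab' /=; apply/orP; right; apply/existsP; exists a; rewrite ab aa' orbT.
suff: {subset A <= [set p in A | P p.1 p.2 == P u v]}.
  by move=> h /h; rewrite inE => /andP[_ /eqP ->] /h; rewrite inE => /andP[_ /eqP ->].
(* Induction on the iterates from the empty set: a new pair is forced by one where [P] already has
   the value [P u v]. *)
apply/subsetP; rewrite {1}/A /gamma_closure /fixset; elim: #|_| => [|k IH] /=; first exact: sub0set.
set B := iter k _ set0 in IH *; apply: subset_trans (@Fm e _ _ _ IH) _.
apply/subsetP => p; rewrite !inE => /orP[/eqP ->|/andP[e1 /existsP[z hz]]].
  by rewrite uvA eqxx.
have pA : p \in A.
  rewrite AF !inE e1 /=; apply/orP; right; apply/existsP; exists z.
  by case/orP: hz; rewrite !inE => /andP[/andP[-> _] ->]; rewrite ?orbT.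
rewrite pA /=; move: pA; rewrite [p]surjective_pairing /= => pA.
case/orP: hz; rewrite !inE /= => /andP[/andP[zA /eqP <-] ne]; apply/eqP.
  by apply/esym/Pr.
by apply/esym/Pl.
Qed.

Section Class.
Variables (e : rel T) (A : {set T * T}).
Hypothesis cA : implication_class e A.

Definition ehat : rel T := fun x y => ((x, y) \in A) || ((y, x) \in A).
Definition erem : rel T := fun x y => e x y && ~~ ehat x y.
Definition span : {set T} := [set x | [exists y, ehat x y]].

Lemma ehat_sym : symmetric ehat. Proof. by move=> x y; rewrite /ehat orbC. Qed.

Lemma spanP x : x \in span -> exists2 p, p \in A & x = p.1 \/ x = p.2.
Proof.
by rewrite inE => /existsP[y /orP[h|h]]; [exists (x, y) | exists (y, x)] => //; [left | right].
Qed.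

Variable F : rel T.
Hypothesis oF : torient e F.
Let es : symmetric e := torient_sym oF.
Let ei : irreflexive e := torient_irr oF.

Lemma hat_r a b b' : ehat a b -> e a b' -> ~~ e b b' -> ehat a b'.
Proof.
move=> /orP[h|h] h1 h2; first by rewrite /ehat (class_r cA h).
by rewrite /ehat (class_l cA h) ?orbT // es.
Qed.

(** A vertex adjacent to just one end of a class pair would be forced into the class. So adjacency
    to [b] is constant along each pair, and by connectedness along the whole class. *)
Lemma span_module b x x' : b \notin span -> x \in span -> x' \in span -> e b x = e b x'.
Proof.
move=> bM.
have sub x1 y1 : (x1, y1) \in A -> e b x1 = e b y1.
  have half u v : ehat u v -> e b u -> e b v.
    move=> uv bu; apply/negPn/negP => bv; case/negP: bM.
    have : ehat u b by apply: hat_r uv _ _; rewrite es.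
    by rewrite inE => h; apply/existsP; exists u; rewrite ehat_sym.
  by move=> h; apply/idP/idP; apply: half; rewrite /ehat h ?orbT.
have con a1 b1 c d : (a1, b1) \in A -> (c, d) \in A -> e b a1 = e b c.
  apply: (class_connected cA (P := fun x y => e b x)) => // a2 a2' b2 h1 h2 _.
  by rewrite (sub _ _ h1) (sub _ _ h2).
move=> /spanP[[a1 b1] h1 x1] /spanP[[a2 b2] h2 x2].
have -> : e b x = e b a1 by case: x1 => ->; rewrite //= (sub _ _ h1).
have -> : e b x' = e b a2 by case: x2 => ->; rewrite //= (sub _ _ h2).
exact: con h1 h2.
Qed.

(* Triangle lemma: [erem b x] and [erem b y] propagate along the whole class. *)
Lemma triangle_notin_span a b c :
  (a, c) \in A -> erem a b -> erem b c -> b \notin span.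
Proof.
move=> ac ab bc; pose P x y := erem x b && erem b y.
have reml x x' y : ehat x y -> ~~ e x x' -> e x' y -> erem x b -> erem b y -> erem x' b.
  move=> xy nxx x'y /andP[exb nxb] /andP[eby nby].
  have x'b : e x' b.
    apply/negPn/negP => h; case/negP: nby; rewrite ehat_sym.
    have yx' : ehat y x'.
      by apply: hat_r (_ : ehat y x) _ nxx; rewrite 1?ehat_sym // es.
    by apply: hat_r yx' _ h; rewrite es.
  rewrite /erem x'b /=; apply/negP => h; case/negP: nxb; rewrite ehat_sym.
  by apply: hat_r (_ : ehat b x') _ _; rewrite 1?ehat_sym // es // es.
have con x1 y1 : (x1, y1) \in A -> P x1 y1.
  move=> h; have <- : P a c = P x1 y1; last by rewrite /P ab bc.
  have eremC x y : erem x y = erem y x by rewrite /erem es ehat_sym.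
  apply: (class_connected cA) h => // [x y y' h1 h2 n|x x' y h1 h2 n]; rewrite /P.
    apply/andP/andP => -[h3 h4]; split=> //; rewrite eremC.
      apply: (reml y y' x) => //; rewrite 1?eremC //.
      + by rewrite /ehat h1 orbT.
      + by rewrite es (class_sub cA h2).
    apply: (reml y' y x) => //; rewrite 1?eremC //.
    + by rewrite /ehat h2 orbT.
    + by rewrite es.
    + by rewrite es (class_sub cA h1).
  apply/andP/andP => -[h3 h4]; split=> //.
    apply: (reml x x' y) => //; first by rewrite /ehat h1.
    exact: class_sub h2.
  apply: (reml x' x y) => //; first by rewrite /ehat h2.
    by rewrite es.
  exact: class_sub h1.
(* At a class pair containing [b], [con] would give [erem b b]. *)
apply/negP => /spanP[[x y] h [] /= e1]; move: (con _ _ h); rewrite /P e1 /erem ei //=.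
by rewrite andbF.
Qed.

(** If [F] disagreed on two pairs sharing an end, transitivity through that end would make the two
    other ends adjacent, against the forcing condition. *)
Lemma class_orient : (forall x y, (x, y) \in A -> F x y) \/ (forall x y, (x, y) \in A -> F y x).
Proof.
case: oF => oe oa ot.
have con x1 y1 x2 y2 : (x1, y1) \in A -> (x2, y2) \in A -> F x1 y1 = F x2 y2.
  apply: (class_connected cA) => {x1 y1 x2 y2} [x y y' h1 h2 n|x x' y h1 h2 n].
    apply/idP/idP => f; apply/negPn/negP => g; case/negP: n; rewrite oe.
      have : F y' x by move: (class_sub cA h2); rewrite oe (negPf g).
      by move=> /ot /(_ f) ->; rewrite orbT.
    have : F y x by move: (class_sub cA h1); rewrite oe (negPf g).
    by move=> /ot /(_ f) ->.
  apply/idP/idP => f; apply/negPn/negP => g; case/negP: n; rewrite oe.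
    have : F y x' by move: (class_sub cA h2); rewrite oe (negPf g).
    by move=> h; rewrite (ot _ _ _ f h).
  have : F y x by move: (class_sub cA h1); rewrite oe (negPf g).
  by move=> h; rewrite (ot _ _ _ f h) orbT.
case: (set_0Vmem A) => [->|[[u v] uv]]; first by left=> x y; rewrite inE.
have [f|f] := boolP (F u v); [left|right] => x y h.
  by rewrite (con _ _ _ _ h uv).
have : ~~ F x y by rewrite (con _ _ _ _ h uv).
by move: (class_sub cA h); rewrite oe => /orP[->|].
Qed.

Lemma class_antisym x y : (x, y) \in A -> (y, x) \notin A.
Proof.
case: oF => _ oa _ h; apply/negP => h'; case: class_orient => c.
  by move: (oa _ _ (c _ _ h)); rewrite (c _ _ h').
by move: (oa _ _ (c _ _ h)); rewrite (c _ _ h').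
Qed.

Lemma class_trans x y z : (x, y) \in A -> (y, z) \in A -> (x, z) \in A.
Proof.
move=> xy yz; have exy := class_sub cA xy; have eyz := class_sub cA yz.
have exz : e x z.
  apply/negPn/negP => h; have : (y, x) \in A by apply: (class_r cA yz); rewrite es.
  by move=> h'; move: (class_antisym xy); rewrite h'.
apply/negPn/negP => nxz.
have nzx : (z, x) \notin A.
  apply/negP => zx; case: oF => _ oa ot; case: class_orient => c.
    by move: (oa _ _ (c _ _ zx)); rewrite (ot _ _ _ (c _ _ xy) (c _ _ yz)).
  by move: (oa _ _ (c _ _ zx)); rewrite (ot _ _ _ (c _ _ yz) (c _ _ xy)).
have rxz : erem x z by rewrite /erem exz /ehat negb_or nxz nzx.
(* Holds at [(y, z)] and spreads over the class; at [(x, y)] it would put [(x, x)] in the class. *)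
pose P u v := ((x, u) \in A) && erem x v.
have con u v : (u, v) \in A -> P u v.
  move=> h; have <- : P y z = P u v; last by rewrite /P xy rxz.
  have main1 u1 v1 v2 : (u1, v1) \in A -> (u1, v2) \in A -> ~~ e v1 v2 -> P u1 v1 -> P u1 v2.
    move=> h1 h2 n /andP[xu /andP[exv nh]]; rewrite /P xu /=.
    have exv2 : e x v2.
      apply/negPn/negP => g; move: (class_antisym xu) => /negP; apply.
      by apply: (class_r cA h2); rewrite es // (class_sub cA xu).
    rewrite /erem exv2 /=; apply: contra nh => g; apply: hat_r g exv _.
    by rewrite es.
  have main2 u1 u2 v1 : (u1, v1) \in A -> (u2, v1) \in A -> ~~ e u1 u2 -> P u1 v1 -> P u2 v1.
    move=> h1 h2 n /andP[xu /andP[exv nh]]; rewrite /P /erem exv nh !andbT.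
    apply: (class_r cA xu) n; apply/negPn/negP => g; case/negP: nh.
    by rewrite /ehat (class_l cA h2 exv) // es.
  apply: (class_connected cA) h => // [x1 y1 y1' h1 h2 n|x1 x1' y1 h1 h2 n].
    by apply/idP/idP; apply: main1; rewrite // es.
  by apply/idP/idP; apply: main2; rewrite // es.
by move: (con _ _ xy); rewrite /P => /andP[/(class_sub cA)]; rewrite ei.
Qed.

(** [F] restricted to [erem] may fail to be transitive: a vertex outside [span] may lie between the
    two ends of a class pair. Hence all edges from an outside vertex to the module are turned the
    way [F] turns the edge to one representative. *)
Lemma remainder_orientable_fwd : (forall x y, (x, y) \in A -> F x y) ->
  exists F', torient erem F'.
Proof.
move=> AF; case: (oF) => oe oa ot.
case: (set_0Vmem span) => [s0|[m mM]].
  exists F; split=> // x y; rewrite /erem -oe.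
  case: (boolP (ehat x y)) => h; rewrite ?andbT //.
  by have: x \in span; [rewrite inE; apply/existsP; exists y | rewrite s0 inE].
(* Outside the module [span], contract it to its representative [m]. *)
pose r x := if x \in span then m else x.
pose G x y := if (x \in span) && (y \in span) then F x y else F (r x) (r y).
have eM x y : x \notin span -> erem x y = e x y.
  move=> xM; rewrite /erem; case: (boolP (ehat x y)) => h; rewrite ?andbT //.
  by case/negP: xM; rewrite inE; apply/existsP; exists y.
have eM' x y : y \notin span -> erem x y = e x y.
  by move=> h; have := eM y x h; rewrite /erem ehat_sym es.
have er x y : ~~ ((x \in span) && (y \in span)) -> e x y = e (r x) (r y).
  rewrite /r negb_and; case: ifPn => hx; case: ifPn => hy //= _.
    by rewrite es [RHS]es (span_module hy hx mM).
  exact: (span_module hx hy mM).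
exists (fun x y => erem x y && G x y); split=> [x y|x y|y x z].
- rewrite [erem y x]/erem ehat_sym es -/(erem x y) -andb_orr.
  case h: (erem x y) => //=; move/andP: h => [h _]; rewrite /G andbC.
  case: ifPn => hh; first by rewrite -oe h.
  by rewrite -oe -er // 1?andbC.
- case/andP=> _; rewrite negb_and /G andbC => h; apply/orP; right.
  by move: h; case: ifP => _; apply: oa.
case/andP=> exy gxy /andP[eyz gyz].
case: (boolP [&& x \in span, y \in span & z \in span]) => [/and3P[xM yM zM]|nall].
  move: gxy gyz; rewrite /G xM yM zM /= => gxy gyz; have gxz := ot _ _ _ gxy gyz.
  (* The triangle lemma keeps [(x, z)] out of the class; [AF] and antisymmetry keep [(z, x)] out. *)
  rewrite gxz andbT /erem oe gxz /= /ehat negb_or; apply/andP; split; apply/negP => h.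
    by move: (triangle_notin_span h exy eyz); rewrite yM.
  by move: (oa _ _ gxz); rewrite AF.
have rxy : ~~ ((x \in span) && (y \in span)) -> F (r x) (r y).
  by move=> h; move: gxy; rewrite /G (negPf h).
have ryz : ~~ ((y \in span) && (z \in span)) -> F (r y) (r z).
  by move=> h; move: gyz; rewrite /G (negPf h).
have [xM|xM] := boolP (x \in span); have [zM|zM] := boolP (z \in span).
(* Both ends collapse to [m], and [y] would lie on both sides of it: this is the configuration that
   the contraction rules out. *)
- move: nall rxy ryz; rewrite xM zM /= andbT /r => yM; rewrite xM zM (negPf yM) /=.
  by move=> /(_ isT) h /(_ isT); rewrite (negPf (oa _ _ h)).
- have gxz : F (r x) (r z).
    move: rxy ryz; rewrite xM (negPf zM) andbF => rxy /(_ isT) ryz.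
    have [yM|yM] := boolP (y \in span); first by move: ryz; rewrite /r yM xM.
    by apply: ot ryz; apply: rxy; rewrite yM.
  by rewrite eM' // er ?(negPf zM) ?andbF // oe gxz /= /G (negPf zM) andbF.
- have gxz : F (r x) (r z).
    move: rxy ryz; rewrite zM (negPf xM) andbT => /(_ isT) rxy ryz.
    have [yM|yM] := boolP (y \in span); first by move: rxy; rewrite /r yM zM.
    by apply: ot rxy _; apply: ryz.
  by rewrite eM // er ?(negPf xM) // oe gxz /= /G (negPf xM).
- have gxz : F (r x) (r z).
    by move: rxy ryz; rewrite (negPf xM) (negPf zM) andbF => /(_ isT) rxy /(_ isT); apply: ot.
  by rewrite eM // er ?(negPf xM) // oe gxz /= /G (negPf xM).
Qed.

(** The orientation [G] is arbitrary, so the algorithm never revises a choice. If [a b] is in the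
    class and [b c] in [G], then [a c] is an edge, since otherwise [c b] would be forced into the
    class; turning it from [c] to [a] would put [c b] in the class or [b a] in [G]. *)
Lemma union_torient G : torient erem G ->
  torient e (fun x y => ((x, y) \in A) || G x y).
Proof.
case=> ge ga gt.
have Gr x y : G x y -> erem x y by move=> h; rewrite ge h.
have eh x y : ehat x y -> e x y by case/orP=> /(class_sub cA) //; rewrite es.
split=> [x y|x y|y x z].
- transitivity (ehat x y || erem x y).
    rewrite /erem; move: (eh x y); case: (ehat x y); case: (e x y) => //= h.
    by have := h isT.
  by rewrite ge /ehat; case: (_ \in A); case: (_ \in A); case: (G x y).
- case/orP => [h|h]; rewrite negb_or.
    rewrite (class_antisym h) /=; apply/negP => /Gr /andP[_].
    by rewrite /ehat h orbT.
  rewrite (ga _ _ h) andbT; move/Gr: h => /andP[_]; rewrite /ehat negb_or => /andP[] //.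
have AG a b c : (a, b) \in A -> G b c -> ((a, c) \in A) || G a c.
  move=> ab bc; have /andP[ebc] := Gr _ _ bc; rewrite /ehat negb_or => /andP[nbc ncb].
  have eab := class_sub cA ab.
  have eac : e a c.
    apply/negPn/negP => h; case/negP: ncb; apply: (class_l cA ab) h.
    by rewrite es.
  case: (boolP ((a, c) \in A)) => //= nac.
  have nca : (c, a) \notin A by apply: contra ncb => ca; apply: class_trans ca ab.
  have : erem a c by rewrite /erem eac /ehat negb_or nac nca.
  rewrite ge => /orP[//|ca].
  by have /Gr/andP[_] := gt _ _ _ bc ca; rewrite /ehat ab orbT.
have GA a b c : G a b -> (b, c) \in A -> ((a, c) \in A) || G a c.
  move=> ab bc; have /andP[eab] := Gr _ _ ab; rewrite /ehat negb_or => /andP[nab nba].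
  have ebc := class_sub cA bc.
  have eac : e a c.
    apply/negPn/negP => h; case/negP: nba; by apply: (class_r cA bc); rewrite es.
  case: (boolP ((a, c) \in A)) => //= nac.
  have nca : (c, a) \notin A by apply: contra nba => ca; apply: class_trans bc ca.
  have : erem a c by rewrite /erem eac /ehat negb_or nac nca.
  rewrite ge => /orP[//|ca].
  by have /Gr/andP[_] := gt _ _ _ ca ab; rewrite /ehat bc orbT.
case/orP=> [xy|xy] /orP[yz|yz].
- by rewrite (class_trans xy yz).
- exact: AG xy yz.
- exact: GA xy yz.
- by rewrite (gt _ _ _ xy yz) orbT.
Qed.

End Class.

Lemma remainder_orientable e A F : implication_class e A -> torient e F ->
  exists F', torient (erem e A) F'.
Proof.
move=> cA oF; case: (class_orient cA oF) => AF; first exact: remainder_orientable_fwd oF AF.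
exact: remainder_orientable_fwd (torient_rev oF) AF.
Qed.

End TransitiveOrientation.

(** * Maximum chains and transversals *)

Lemma card_ord_lt m q : q <= m -> #|[set i : 'I_m | i < q]| = q.
Proof.
move=> qm; rewrite cardsE -sum1_card (eq_bigl (fun i : 'I_m => i < q)) //.
by rewrite -(big_ord_widen m (fun _ => 1)) // sum1_card card_ord.
Qed.

Section Chains.
Variables (T : finType) (G : sgraph T) (F : rel T).
Hypothesis oF : torient (compl_adj G) F.
Let mc := maximum_independent G.

Let Ftr : transitive F. Proof. by case: oF. Qed.

Let Fas x y : F x y -> F y x -> False.
Proof. by case: oF => _ oa _ /oa /negP. Qed.

Let Firr x : F x x = false.
Proof. by apply/negP => h; case: (Fas h h). Qed.

Definition le_of (x y : T) : bool := (x == y) || F x y.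
Local Notation le := le_of.

Lemma le_of_refl x : le x x. Proof. by rewrite /le eqxx. Qed.

Lemma le_of_trans : transitive le.
Proof.
move=> y x z xy yz; case/orP: xy => [/eqP -> //|xy].
by case/orP: yz => [/eqP <-|/(Ftr xy) xz]; rewrite /le ?xy ?xz orbT.
Qed.

Lemma le_of_anti x y : le x y -> le y x -> x = y.
Proof. by move=> /orP[/eqP //|xy] /orP[/eqP //|yx]; case: (Fas xy yx). Qed.

Lemma independentP (I : {set T}) :
  reflect {in I &, forall x y, le x y || le y x} (independent G I).
Proof.
case: oF => oe _ _; have ge x y : ~~ adj G x y = le x y || le y x.
  have := oe x y; rewrite /compl_adj /le (eq_sym y x).
  by case: eqP => [->|_] /=; rewrite ?adj_irr // => ->.
apply: (iffP idP) => [/forall_inP h x y xI yI|h].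
  by rewrite -ge; move/forall_inP: (h x xI); apply.
by apply/forall_inP => x xI; apply/forall_inP => y yI; rewrite ge h.
Qed.

Lemma independent_le_alpha (I : {set T}) : independent G I -> #|I| <= alpha G.
Proof. by move=> h; rewrite /alpha (leq_bigmax_cond (F := fun I : {set T} => #|I|)). Qed.

Lemma maximum_independent_exists : exists I, mc I.
Proof.
have h0 : 0 < #|[pred I | independent G I]|.
  apply/card_gt0P; exists set0; rewrite inE; apply/forall_inP => x; by rewrite inE.
have [I hI e] := eq_bigmax_cond (fun I : {set T} => #|I|) h0.
by exists I; rewrite /mc /maximum_independent; move: hI; rewrite inE => ->; rewrite /alpha e eqxx.
Qed.

Definition down (I : {set T}) y := [set z in I | le z y].
Definition up (I : {set T}) y := [set z in I | le y z].

(** The two hybrids of [I] and [J] at [y] are chains with [2 * alpha G] elements in total, and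
    neither exceeds [alpha G]; so both attain it. *)
Lemma splice I J y : mc I -> mc J -> y \in I -> y \in J -> mc (down I y :|: up J y).
Proof.
have cardDU (I' J' : {set T}) : y \in I' -> y \in J' ->
    #|down I' y :|: up J' y| + 1 = #|down I' y| + #|up J' y|.
  move=> yI yJ; rewrite -cardsUI; congr (_ + _).
  rewrite (_ : _ :&: _ = [set y]) ?cards1 //; apply/setP => z; rewrite !inE.
  apply/idP/eqP => [/andP[/andP[_ h1] /andP[_ h2]]|->]; first exact: le_of_anti.
  by rewrite yI yJ le_of_refl.
have DU (I' : {set T}) : y \in I' -> independent G I' -> down I' y :|: up I' y = I'.
  move=> yI /independentP h; apply/setP => z; rewrite !inE -andb_orr.
  by apply/andP/idP => [[] //|zI]; rewrite zI h.
have ind (I' J' : {set T}) : independent G I' -> independent G J' ->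
    independent G (down I' y :|: up J' y).
  move=> /independentP hI /independentP hJ; apply/independentP => u v; rewrite !inE.
  move=> /orP[/andP[u1 u2]|/andP[u1 u2]] /orP[/andP[v1 v2]|/andP[v1 v2]].
  - exact: hI.
  - by rewrite (le_of_trans u2 v2).
  - by rewrite (le_of_trans v2 u2) orbT.
  - exact: hJ.
move=> /andP[iI /eqP aI] /andP[iJ /eqP aJ] yI yJ; rewrite /mc /maximum_independent ind //=.
have h1 := cardDU _ _ yI yI; have h2 := cardDU _ _ yJ yJ.
have h3 := cardDU _ _ yI yJ; have h4 := cardDU _ _ yJ yI.
have := independent_le_alpha (ind _ _ iI iJ); have := independent_le_alpha (ind _ _ iJ iI).
by move: h1 h2; rewrite !DU // aI aJ; lia.
Qed.

(** [x] precedes or equals [y] on some maximum chain. *)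
Definition sq (x y : T) : bool := le x y && [exists I, [&& mc I, x \in I & y \in I]].

Definition spanned : {set T} := [set x | sq x x].

Lemma sqP x y : reflect (le x y /\ exists I, [/\ mc I, x \in I & y \in I]) (sq x y).
Proof.
apply: (iffP andP) => -[h].
  by move=> /existsP[I /and3P[h1 h2 h3]]; split=> //; exists I.
by move=> [I [h1 h2 h3]]; split=> //; apply/existsP; exists I; apply/and3P.
Qed.

Lemma sq_spanned x y : sq x y -> (x \in spanned) && (y \in spanned).
Proof.
move=> /sqP[_ [I [h1 h2 h3]]]; rewrite !inE.
by apply/andP; split; apply/sqP; split; rewrite ?le_of_refl //; exists I.
Qed.

Lemma mc_spanned I x : mc I -> x \in I -> x \in spanned.
Proof. by move=> h xI; rewrite inE; apply/sqP; split; [exact: le_of_refl | exists I]. Qed.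

(** Paths of exactly [t] arcs. For a transitive irreflexive [F] the vertices of such a path form a
    chain of [t + 1] elements. *)
Fixpoint steps (t : nat) (x y : T) : bool :=
  if t is t'.+1 then [exists z, steps t' x z && F z y] else x == y.

Lemma steps_path x p : path F x p -> steps (size p) x (last x p).
Proof.
elim/last_ind: p => [|p y IH]; first by rewrite /= eqxx.
rewrite rcons_path size_rcons last_rcons => /andP[/IH h1 h2] /=.
by apply/existsP; exists (last x p); rewrite h1.
Qed.

Lemma path_steps t x y : steps t x y -> exists p, [/\ path F x p, last x p = y & size p = t].
Proof.
elim: t y => [|t IH] y /=; first by move/eqP ->; exists [::].
move=> /existsP[z /andP[/IH [p [h1 h2 h3]] zy]].
by exists (rcons p y); rewrite rcons_path last_rcons size_rcons h1 h2 h3.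
Qed.

Lemma path_independent x p : path F x p ->
  independent G [set z in x :: p] /\ #|[set z in x :: p]| = (size p).+1.
Proof.
move=> h; have so : sorted F (x :: p) by [].
have un : uniq (x :: p).
  by apply: (sorted_uniq Ftr) => // z; rewrite Firr.
split; last by rewrite cardsE (card_uniqP un).
apply/independentP => u v; rewrite !inE -!in_cons => hu hv.
have [<-|ne] := eqVneq u v; first by rewrite le_of_refl.
have := sorted_leq_nth le_of_trans le_of_refl x (s := x :: p).
have -> : sorted le (x :: p).
  by apply: sub_sorted so => a b ab; rewrite /le ab orbT.
move=> /(_ isT) mono.
have := mono (index u (x :: p)) (index v (x :: p)); rewrite !inE !index_mem !nth_index //.
have := mono (index v (x :: p)) (index u (x :: p)); rewrite !inE !index_mem !nth_index //.
move=> /(_ hv hu) m1 /(_ hu hv) m2.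
by case/orP: (leq_total (index u (x :: p)) (index v (x :: p))) => [/m2 ->|/m1 ->] //; rewrite orbT.
Qed.

Lemma independent_path (I : {set T}) : independent G I ->
  exists s, [/\ sorted F s, s =i I & size s = #|I|].
Proof.
move=> /independentP h; pose s := sort le (enum I); exists s.
have sI : s =i I by move=> z; rewrite mem_sort mem_enum.
split=> //; last by rewrite size_sort cardE.
have sl : sorted le s.
  apply: (sort_sorted_in (P := mem I)) => //.
  by apply/allP => z; rewrite mem_enum.
have un : uniq s by rewrite sort_uniq enum_uniq.
(* Being sorted for [le] and free of repetitions amounts to being sorted for [F]. *)
rewrite (sorted_pairwise Ftr); move: sl un; rewrite (sorted_pairwise le_of_trans) uniq_pairwise.
move=> h1 h2; have := conj h1 h2 => /andP; rewrite -pairwise_relI.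
by apply: sub_pairwise => a b /andP[/orP[/eqP ->|//]]; rewrite /= eqxx.
Qed.

(** Thus [alpha G] is the number of lengths realised by some path, which is how the program computes
    it. *)
Lemma steps_lt_alpha t : (exists x y, steps t x y) <-> t < alpha G.
Proof.
split=> [[x [y /path_steps[p [h1 _ <-]]]]|lt].
  have [h2 <-] := path_independent h1; exact: independent_le_alpha.
have [I /andP[iI /eqP aI]] := maximum_independent_exists.
have [[|x p] [so _ sz]] := independent_path iI; first by rewrite -aI -sz in lt.
exists x, (last x (take t p)).
have st : size (take t p) = t by rewrite size_takel // -ltnS (leq_trans lt) // -aI -sz.
by rewrite -{1}st; apply: steps_path; apply: take_path.
Qed.

(** A maximum chain through [x] and [y] is cut there into three paths; the final 1 converts arcs
    into vertices. *)
Lemma sq_steps x y : sq x y <-> exists a b t1 t2 t3,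
  [/\ steps t1 a x, steps t2 x y, steps t3 y b & t1 + t2 + t3 + 1 = alpha G].
Proof.
split=> [/sqP[xy [I [/andP[iI /eqP aI] xI yI]]]|[a [b [t1 [t2 [t3 []]]]]]].
  have [s [so sI sz]] := independent_path iI.
  move: xI yI; rewrite -!sI => xs ys; case/splitPr: xs so sI sz ys => p1 p2 so _ sz ys.
  pose a := head x p1.
  have s1 : steps (size p1) a x.
    rewrite /a; move: so; case: (p1) => [|a' p1'] /=; first by rewrite eqxx.
    rewrite cat_path => /andP[h1 /andP[h2 _]].
    have := @steps_path a' (rcons p1' x); rewrite rcons_path h1 h2 last_rcons size_rcons.
    by apply.
  have pw := so; rewrite (sorted_pairwise Ftr) pairwise_cat in pw.
  have p2x : path F x p2 by move: so; case: (p1) => //= a' p1'; rewrite cat_path => /and3P[].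
  have [e|ne] := eqVneq y x.
    exists a, (last x p2), (size p1), 0, (size p2); split=> //=.
    - by rewrite e.
    - by rewrite e; apply: steps_path.
    - by move: sz; rewrite size_cat /= aI; lia.
  have yp2 : y \in p2.
    move: ys; rewrite mem_cat in_cons (negPf ne) /= => /orP[yp1|//].
    case/and3P: pw => /allrelP /(_ y x yp1) h _ _; have yx := h (mem_head _ _).
    by case/orP: xy => [/eqP e|/Fas /(_ yx)//]; rewrite e eqxx in ne.
  case/splitPr: yp2 p2x sz {so ys pw} => p3 p4; rewrite cat_path => /and3P[h1 h2 h3] sz.
  exists a, (last y p4), (size p1), (size p3).+1, (size p4); split=> //.
  - have := @steps_path x (rcons p3 y); rewrite rcons_path h1 h2 last_rcons size_rcons.
    by apply.
  - exact: steps_path.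
  - by move: sz; rewrite !size_cat /= size_cat /= aI; lia.
move=> /path_steps[p1 [h1 l1 <-]] /path_steps[p2 [h2 l2 <-]] /path_steps[p3 [h3 l3 <-]] sz.
have hp : path F a (p1 ++ (p2 ++ p3)) by rewrite !cat_path h1 l1 h2 l2 h3.
have [iI cI] := path_independent hp.
have xI : x \in a :: p1 ++ p2 ++ p3 by rewrite -cat_cons mem_cat -l1 mem_last.
have yI : y \in a :: p1 ++ p2 ++ p3.
  by rewrite catA -cat_cons mem_cat -l2 -l1 -last_cat mem_last.
apply/sqP; split.
  rewrite -l2; elim: p2 (x) h2 {hp iI cI xI yI sz l2} => [|z p IH] u /=; first by rewrite le_of_refl.
  by move=> /andP[uz /IH]; apply: le_of_trans; rewrite /le uz orbT.
exists [set z in a :: p1 ++ p2 ++ p3]; rewrite !inE; split=> //.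
apply/andP; split=> //; rewrite cI !size_cat; apply/eqP; lia.
Qed.

(** * Transversals and vertex covers of the product *)

Section Product.

(** The comparability graph of the product of [spanned] with a chain of [q]
    elements, an antichain of which projects to a union of [q] antichains. *)
Variables (d m : nat).
Let q := alpha G - d.
Hypotheses (d_le : d <= alpha G) (q_le : q <= m).

Definition pgraph (p r : T * 'I_m) : bool :=
  [&& sq p.1 r.1, p.2 <= r.2, r.2 < q & p != r].

Definition vcover (L R : finType) (E : L -> R -> bool) (CL : {set L}) (CR : {set R}) :=
  forall l r, E l r -> (l \in CL) || (r \in CR).

Let P := setX spanned [set i : 'I_m | i < q].

Let cardP : #|P| = #|spanned| * q.
Proof. by rewrite cardsX card_ord_lt. Qed.

(** [f x] counts, at best, the vertices outside [S] up to [x] on a maximum chain through [x]. It is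
    at most [q] and grows along [sq] at each vertex outside [S], so lifting such a vertex to level
    [q - f x] yields an antichain [A], whose complement in [P] is the cover. *)
Lemma cover_of_transversal (S : {set T}) :
  (forall I, mc I -> d <= #|I :&: S|) ->
  exists CL CR, vcover pgraph CL CR /\
    #|CL| + #|CR| + #|spanned| <= #|spanned| * q + #|S|.
Proof.
move=> hS; pose f x := \max_(I | mc I && (x \in I)) #|down I x :\: S|.
have fq x : f x <= q.
  apply/bigmax_leqP => I /andP[hI xI]; apply: (@leq_trans #|I :\: S|).
    by apply/subset_leq_card/setSD/subsetP => z; rewrite inE => /andP[].
  have := hS _ hI; have := cardsID S I; case/andP: hI => _ /eqP ->; rewrite /q; lia.
have ge_f I x : mc I -> x \in I -> #|down I x :\: S| <= f x.
  by move=> hI xI; apply: (leq_bigmax_cond (F := fun I => #|down I x :\: S|)); rewrite hI.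
(* A chain optimal for [x] is spliced at [x] with one containing both vertices. *)
have fmon x y : sq x y -> f x + ((x != y) && (y \notin S)) <= f y.
  move=> /sqP[xy [J [hJ xJ yJ]]].
  have h0 : 0 < #|[pred I | mc I && (x \in I)]|.
    by apply/card_gt0P; exists J; rewrite inE hJ.
  have [I] := eq_bigmax_cond (fun I => #|down I x :\: S|) h0.
  rewrite inE => /andP[hI xI]; rewrite -/(f x) => ->.
  have hK := splice hI hJ xI xJ; set K := _ :|: _ in hK.
  have yK : y \in K by rewrite !inE yJ xy orbT.
  apply: leq_trans (ge_f _ _ hK yK).
  have sub : down I x :\: S \subset down K y :\: S.
    apply: setSD; apply/subsetP => z; rewrite !inE => /andP[zI zx].
    by rewrite zI zx (le_of_trans zx xy).
  case: eqP => /= [_|ne]; first by rewrite addn0 subset_leq_card.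
  case: (boolP (y \in S)) => /= yS; first by rewrite addn0 subset_leq_card.
  rewrite addn1; apply/proper_card; rewrite properE sub /=.
  apply/subsetPn; exists y; rewrite !inE; first by rewrite yS yJ xy le_of_refl orbT.
  by rewrite yS /=; apply/negP => /andP[_ yx]; apply: ne; apply: le_of_anti.
pose A := [set p in P | (p.1 \notin S) && (p.2 + f p.1 == q)].
pose W := [set p in P | q <= p.2 + f p.1].
have AW : A \subset W.
  by apply/subsetP => p; rewrite inE => /and3P[pP _ /eqP h]; rewrite inE pP h /=.
have WP : W \subset P by apply/subsetP => p; rewrite inE => /andP[].
(* [W] is the up-set of points at or above level [q - f]. An edge starting outside [W] is covered on
   the left; one starting in [W] ends in [W], and strictly above every point of [A] it could hit. *)
exists (P :\: W), (W :\: A); split.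
  move=> [x i] [y j] /and4P[/= sxy ij jq ne]; have /andP[xU yU] := sq_spanned sxy.
  have iq := leq_ltn_trans ij jq.
  have xP : (x, i) \in P by rewrite in_setX xU inE.
  have yP : (y, j) \in P by rewrite in_setX yU inE.
  rewrite in_setD xP andbT; case: (boolP ((x, i) \in W)) => //= xW.
  have fi : q <= i + f x by move: xW; rewrite inE /= => /andP[].
  have fxy := fmon _ _ sxy.
  rewrite in_setD [_ \in W]inE yP /=; apply/andP; split; last first.
    exact: leq_trans fi (leq_add ij (leq_trans (leq_addr _ _) fxy)).
  apply/negP; rewrite inE => /and3P[_ /= yS /eqP fj].
  move: fxy; rewrite yS andbT; case: eqP => [e|_] /=; last first.
    by move: fi ij fj; rewrite -/(is_true _); move: (f x) (f y) => u v; clear; lia.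
  have : i != j by apply: contra ne => /eqP ->; rewrite e.
  rewrite -val_eqE /=; move: fi ij fj; rewrite -e; move: (f x) => u; clear; lia.
have A1 : spanned :\: S \subset [set p.1 | p in A].
  apply/subsetP => x; rewrite inE => /andP[xS xU].
  have f1 : 0 < f x.
    have /sqP[_ [I [hI xI _]]] : sq x x by move: xU; rewrite inE.
    apply: leq_trans (ge_f _ _ hI xI); apply/card_gt0P; exists x.
    by rewrite !inE xS xI le_of_refl.
  (* A vertex outside [S] counts itself, so [f x] is positive and the level is below [q]. *)
  have lt : q - f x < m by have := fq x; lia.
  apply/imsetP; exists (x, Ordinal lt) => //; rewrite inE in_setX xU inE xS /=.
  by have := fq x; lia.
have cA : #|spanned :\: S| <= #|A|.
  by apply: leq_trans (subset_leq_card A1) (leq_imset_card _ _).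
have c1 := cardsID W P; have c2 := cardsID A W.
have e1 : #|P :&: W| = #|W| by rewrite (setIidPr WP).
have e2 : #|W :&: A| = #|A| by rewrite (setIidPr AW).
have c3 := cardsID S spanned; have c4 : #|spanned :&: S| <= #|S| by rewrite subset_leq_card // subsetIr.
move: cardP c1 c2 c3 c4 e1 e2 cA; move: (#|spanned| * q) => u; lia.
Qed.

(** The uncovered points [A] form an antichain: two of them never share a vertex, and two whose
    vertices lie on one maximum chain never share a level. So [A] projects injectively onto a set
    [V] having at most [q] elements on every maximum chain, and [S] is the rest of [spanned]. *)
Lemma transversal_of_cover k (CL CR : {set T * 'I_m}) : vcover pgraph CL CR ->
  #|CL| + #|CR| + #|spanned| <= #|spanned| * q + k ->
  exists S : {set T}, #|S| <= k /\ forall I, mc I -> d <= #|I :&: S|.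
Proof.
move=> cov le_k; pose A := P :\: (CL :|: CR).
have noedge p r : p \in A -> r \in A -> pgraph p r = false.
  move=> pA rA; apply/negP => /cov; move: pA rA; rewrite !inE !negb_or.
  by move=> /andP[/andP[/negPf -> _] _] /andP[/andP[_ /negPf ->] _].
have AP p : p \in A -> (p.1 \in spanned) && (p.2 < q).
  by rewrite in_setD => /andP[_]; rewrite [p]surjective_pairing in_setX inE.
have cA : #|P| <= #|A| + (#|CL| + #|CR|).
  have := cardsID (CL :|: CR) P; have : #|P :&: (CL :|: CR)| <= #|CL| + #|CR|.
    apply: leq_trans (subset_leq_card (subsetIr _ _)) _.
    by rewrite cardsU leq_subr.
  by move=> h1 <-; rewrite -/A addnC leq_add2l.
have inj1 : {in A &, injective fst}.
  move=> p r pA rA e; apply/eqP/negPn/negP => ne.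
  wlog le : p r pA rA e ne / p.2 <= r.2.
    move=> H; case: (leqP p.2 r.2) => h; first exact: H h.
    by apply: (H r p) (ltnW h) => //; rewrite eq_sym.
  have /andP[pU pq] := AP _ pA; have /andP[rU rq] := AP _ rA.
  by move: (noedge _ _ pA rA); rewrite /pgraph -e le rq ne; move: pU; rewrite inE => ->.
pose V := [set p.1 | p in A].
have cV : #|V| = #|A| by apply: card_in_imset.
have VU : V \subset spanned by apply/subsetP => x /imsetP[p /AP /andP[h _] ->].
exists (spanned :\: V); split.
  have := cardsID V spanned; rewrite (setIidPr VU).
  move: cardP cA le_k cV; move: (#|spanned| * q) => u; lia.
move=> I hI; have IU : I \subset spanned by apply/subsetP => x; apply: mc_spanned.
have -> : I :&: (spanned :\: V) = I :\: V.
  by rewrite setIDA (setIidPl IU).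
pose AI := [set p in A | p.1 \in I].
have IV : I :&: V \subset [set p.1 | p in AI].
  apply/subsetP => x /setIP[xI /imsetP[p pA e]]; apply/imsetP; exists p => //.
  by rewrite inE pA -e.
have inj2 : {in AI &, injective snd}.
  move=> p r; rewrite ![_ \in AI]inE => /andP[pA pI] /andP[rA rI] e; apply/eqP/negPn/negP => ne.
  wlog le : p r pA rA pI rI e ne / le p.1 r.1.
    move=> H; case/andP: (hI) => /independentP /(_ _ _ pI rI) /orP[h|h] _; first exact: H h.
    by apply: (H r p) h => //; rewrite eq_sym.
  have /andP[_ rq] := AP _ rA.
  suff g : pgraph p r by rewrite noedge in g.
  rewrite /pgraph e leqnn rq ne !andbT.
  by apply/sqP; split=> //; exists I.
have cI : #|I :&: V| <= q.
  apply: leq_trans (subset_leq_card IV) _; apply: leq_trans (leq_imset_card _ _) _.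
  rewrite -(card_in_imset inj2) -[leqRHS](card_ord_lt q_le); apply/subset_leq_card/subsetP => i.
  move=> /imsetP[p]; rewrite [p \in _]inE => /andP[pA _] ->; rewrite inE.
  by have /andP[_] := AP _ pA.
by have := cardsID V I; case/andP: hI => _ /eqP ->; move: cI d_le; rewrite /q; lia.
Qed.

End Product.

End Chains.

Lemma cocomparability_torient (T : finType) (G : sgraph T) : cocomparability G ->
  exists F, torient (compl_adj G) F.
Proof.
move=> [H [lt [[li ltr lto] tr]] GH].
have cH x y : compl_adj G x y = adj H x y.
  rewrite /compl_adj GH /= /compl_adj; case: eqVneq => [->|_] /=; first by rewrite adj_irr.
  by rewrite negbK.
exists (fun x y => adj H x y && lt x y); split=> [x y|x y /andP[_ h]|y x z].
- rewrite cH (adj_sym H y x) -andb_orr; case h: (adj H x y) => //=.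
  apply/esym/lto; apply/negP => /eqP e; by rewrite e adj_irr in h.
- rewrite negb_and; apply/orP; right; apply/negP => h'.
  by move: (ltr _ _ _ h h'); rewrite li.
- move=> /andP[h1 h2] /andP[h3 h4]; rewrite (ltr _ _ _ h2 h4) andbT.
  exact: tr h2 h4 h1 h3.
Qed.

(** * Bipartite matching by auction *)

Section Auction.
Variables (L R : finType) (E : L -> R -> bool).
Implicit Types (M : L -> R -> bool) (p : R -> nat).

Let cap := #|R|.+1.

Definition can_bid M p l r : bool :=
  [&& E l r, ~~ [exists r', M l r'], p r < cap & [forall r', E l r' ==> (p r <= p r')]].

(** [auction_slack] is complementary slackness up to one unit. [auction_price] holds because a right
    vertex, once matched, only changes partner. *)
Record auction_inv M p : Prop := AuctionInv {
  auction_edge l r : M l r -> E l r;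
  auction_fun l r r' : M l r -> M l r' -> r = r';
  auction_inj l l' r : M l r -> M l' r -> l = l';
  auction_price r : 0 < p r -> exists l, M l r;
  auction_slack l r r' : M l r -> E l r' -> p r <= p r' + 1;
  auction_cap r : p r <= cap
}.

Lemma auction_inv0 : auction_inv (fun _ _ => false) (fun _ => 0).
Proof. by []. Qed.

Lemma auction_inv_eq M M' p p' : M =2 M' -> p =1 p' -> auction_inv M p -> auction_inv M' p'.
Proof.
move=> eM ep [h1 h2 h3 h4 h5 h6]; split=> [l r|l r r'|l l' r|r|l r r'|r]; rewrite -?eM -?ep; eauto.
by move=> /h4[l hl]; exists l; rewrite -eM.
Qed.

(** The bidder is slack since [r] was its cheapest neighbour before the raise by one. The former
    owner of [r] is evicted, and for other matched vertices only the larger side of the inequality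
    can grow. *)
Lemma bid_inv M p l r : auction_inv M p -> can_bid M p l r ->
  auction_inv (fun x y => if y == r then x == l else M x y) (fun y => p y + (y == r)).
Proof.
move=> [h1 h2 h3 h4 h5 h6] /and4P[Elr /existsPn ul pr /forall_inP ch].
have nM r' : M l r' = false by apply/negbTE.
split=> [x y|x y y'|x x' y|y|x y y'|y].
- by case: (eqVneq y r) => [->|_]; [move/eqP-> | apply: h1].
- case: (eqVneq y r) => [->|_]; case: (eqVneq y' r) => [->|_] //.
  + by move/eqP ->; rewrite nM.
  + by move=> h /eqP e; rewrite e nM in h.
  + exact: h2.
- by case: (eqVneq y r) => [_|_] /=; [move=> /eqP -> /eqP -> | apply: h3].
- case: (eqVneq y r) => [->|_]; first by exists l.
  by rewrite addn0; apply: h4.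
- case: (eqVneq y r) => [->|_] /=.
    by move/eqP-> => h; apply: leq_add (leq_trans (ch _ h) (leq_addr _ _)) _.
  by move=> hM hE; have := h5 _ _ _ hM hE; lia.
- by case: (eqVneq y r) => [->|_] /=; rewrite ?addn0 // addn1.
Qed.

Lemma sum_bid p r : \sum_y (p y + (y == r)) = \sum_y p y + 1.
Proof.
rewrite big_split /=; congr (_ + _).
by rewrite (bigD1 r) //= eqxx big1 ?addn0 // => y /negPf ->.
Qed.

Lemma auction_sum M p : auction_inv M p -> \sum_y p y <= #|R| * cap.
Proof.
by move=> h; rewrite -sum_nat_const; apply: leq_sum => r _; apply: auction_cap h r.
Qed.

Lemma matching_le_cover M p (CL : {set L}) (CR : {set R}) :
  auction_inv M p -> vcover E CL CR -> #|[set x | M x.1 x.2]| <= #|CL| + #|CR|.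
Proof.
move=> h cov; set A := [set x | _]; rewrite -(cardsID [set x | x.1 \in CL] A); apply: leq_add.
  have inj : {in A :&: [set x | x.1 \in CL] &, injective fst}.
    move=> [x y] [x' y']; rewrite !inE /= => /andP[h1 _] /andP[h2 _] e.
    by rewrite e in h1 *; rewrite (auction_fun h h1 h2).
  rewrite -(card_in_imset inj); apply/subset_leq_card/subsetP => x /imsetP[z].
  by rewrite !inE => /andP[_ hz] ->.
have inj : {in A :\: [set x | x.1 \in CL] &, injective snd}.
  move=> [x y] [x' y']; rewrite !inE /= => /andP[_ h1] /andP[_ h2] e.
  by rewrite e in h1 *; rewrite (auction_inj h h1 h2).
rewrite -(card_in_imset inj); apply/subset_leq_card/subsetP => y /imsetP[z].
rewrite !inE => /andP[nz hz] ->; have := cov _ _ (auction_edge h hz).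
by rewrite (negPf nz).
Qed.

(* More price levels than vertices in [R]: some level [t] is free, and by slackness
   no edge joins the vertices matched above level [t] to the prices below it. *)
Lemma auction_final M p : auction_inv M p -> (forall l r, ~~ can_bid M p l r) ->
  exists CL CR, vcover E CL CR /\ #|CL| + #|CR| = #|[set x | M x.1 x.2]|.
Proof.
move=> h stuck.
have [t t0 tfree] : exists2 t, 0 < t <= cap & forall r, p r <> t.
  have /allPn[t] : ~~ all (mem (codom p)) (iota 1 cap).
    apply/negP => /allP sub; have := uniq_leq_size (iota_uniq 1 cap) sub.
    by rewrite size_iota size_codom ltnn.
  rewrite mem_iota add1n ltnS => t0 tn; exists t => // r e.
  by case/negP: tn; rewrite -e; apply: codom_f.
exists [set l | [exists r, M l r && (p r < t)]], [set r | t <= p r]; split.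
  move=> l r Elr; rewrite !inE; case: leqP => pr; rewrite ?orbT // orbF.
  have [/existsP[r' hM]|un] := boolP [exists r', M l r'].
    apply/existsP; exists r'; rewrite hM /=.
    have := auction_slack h hM Elr; have := tfree r'; lia.
  (* An unmatched [l] with a neighbour priced below [t], hence below the cap, could still bid for
     its cheapest neighbour. *)
  have [r0 hr0 mn] := @arg_minnP _ r (E l) p Elr.
  have /negP[] := stuck l r0; rewrite /can_bid hr0 un /=; apply/andP; split.
    by apply: leq_ltn_trans (mn _ Elr) _; lia.
  by apply/forall_inP.
set CL := [set l | _]; set CR := [set r | _]; set A := [set x | _].
(* Matched pairs below level [t] correspond to [CL], the others to [CR]; every vertex of [CR] is
   matched because [t] is positive. *)
rewrite -(cardsID [set x | p x.2 < t] A); congr (_ + _).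
  have inj : {in A :&: [set x | p x.2 < t] &, injective fst}.
    move=> [x y] [x' y']; rewrite !inE /= => /andP[h1 _] /andP[h2 _] e.
    by rewrite e in h1 *; rewrite (auction_fun h h1 h2).
  rewrite -(card_in_imset inj); apply: eq_card => x; rewrite inE; apply/existsP/imsetP.
    by move=> [r hr]; exists (x, r) => //; rewrite !inE.
  by move=> [[x' r]]; rewrite !inE /= => hr ->; exists r.
have inj : {in A :\: [set x | p x.2 < t] &, injective snd}.
  move=> [x y] [x' y']; rewrite !inE /= => /andP[_ h1] /andP[_ h2] e.
  by rewrite e in h1 *; rewrite (auction_inj h h1 h2).
rewrite -(card_in_imset inj); apply: eq_card => y; rewrite inE; apply/idP/imsetP.
  move=> hy; have [|l hl] := auction_price h (r := y); first by lia.
  by exists (l, y) => //; rewrite !inE /= hl -leqNgt hy.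
by move=> [[l r]]; rewrite !inE /= -leqNgt => /andP[hr _] ->.
Qed.

End Auction.

Lemma iter_until (S : Type) (step : S -> S) (good stop : S -> Prop) (pot : S -> nat) N s k :
  (forall s, good s -> good (step s)) ->
  (forall s, good s -> stop s -> stop (step s)) ->
  (forall s, good s -> stop s \/ pot s < pot (step s)) ->
  (forall s, good s -> pot s <= N) -> good s -> N < k ->
  good (iter k step s) /\ stop (iter k step s).
Proof.
move=> hg hs hp hN gs Nk.
have H i : good (iter i step s) /\ (stop (iter i step s) \/ i <= pot (iter i step s)).
  elim: i => [|i [g IH]] /=; first by split=> //; right.
  split; first exact: hg.
  case: IH => [h|h]; first by left; apply: hs.
  by case: (hp _ g) => [/(hs _ g)|h']; [left | right; apply: leq_trans h'].
have [g [//|h]] := H k; have := hN _ g; lia.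
Qed.

(** * The algorithm *)

(** Truth is being nonzero, so [TSum] acts as an existential quantifier and truncated subtraction as
    strict comparison. [tBit] normalises to 0 or 1 where truth values are counted. *)
Definition tAnd (a b : term) := TIf a b (TConst 0).
Definition tOr (a b : term) := TIf a (TConst 1) b.
Definition tNot (a : term) := TIf a (TConst 0) (TConst 1).
Definition tBit (a : term) := TIf a (TConst 1) (TConst 0).
Definition tLt (a b : term) := TSub b a.
Definition tLe (a b : term) := tNot (TSub a b).
Definition tEq (a b : term) := tAnd (tLe a b) (tLe b a).
Definition tAll (v : nat) (a : term) := tNot (TSum v (tNot a)).

Fixpoint writes (c : command) : seq nat :=
  match c with
  | CSet a _ => [:: a]
  | CSeq c1 c2 => writes c1 ++ writes c2
  | CLoop c1 => writes c1
  end.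

Section Holds.
Variables (n : nat) (w : memory) (s : state n).
Implicit Types (r : nat -> 'I_n) (a b : term).

Definition holds r a : bool := teval w s r a != 0.

Lemma holds_and r a b : holds r (tAnd a b) = holds r a && holds r b.
Proof. by rewrite /holds /=; case: ifP. Qed.

Lemma holds_or r a b : holds r (tOr a b) = holds r a || holds r b.
Proof. by rewrite /holds /=; case: ifP. Qed.

Lemma holds_not r a : holds r (tNot a) = ~~ holds r a.
Proof. by rewrite /holds /=; case: ifP. Qed.

Lemma holds_bit r a : holds r (tBit a) = holds r a.
Proof. by rewrite /holds /=; case: ifP. Qed.

Lemma holds_if r a b c : holds r (TIf a b c) = if holds r a then holds r b else holds r c.
Proof. by rewrite /holds /=; case: ifP. Qed.

Lemma holds_lt r a b : holds r (tLt a b) = (teval w s r a < teval w s r b).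
Proof. by rewrite /holds /= subn_eq0 -ltnNge. Qed.

Lemma holds_le r a b : holds r (tLe a b) = (teval w s r a <= teval w s r b).
Proof. by rewrite holds_not /holds /= negbK subn_eq0. Qed.

Lemma holds_eq r a b : holds r (tEq a b) = (teval w s r a == teval w s r b).
Proof. by rewrite holds_and !holds_le eqn_leq. Qed.

Lemma holds_sum r v a : holds r (TSum v a) = [exists i, holds (upd r v i) a].
Proof. by rewrite /holds /= sum_nat_eq0 negb_forall. Qed.

Lemma holds_all r v a : holds r (tAll v a) = [forall i, holds (upd r v i) a].
Proof.
rewrite holds_not holds_sum negb_exists; apply: eq_forallb => i.
by rewrite holds_not negbK.
Qed.

Lemma holds_arr r (a i j k l : nat) : holds r (TArr a i j k l) = (s a (r i) (r j) (r k) (r l) != 0).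
Proof. by []. Qed.

Lemma holds_const r c : holds r (TConst c) = (c != 0).
Proof. by []. Qed.

Definition holdsE := (holds_and, holds_or, holds_not, holds_bit, holds_lt, holds_le,
  holds_eq, holds_all, holds_sum, holds_arr, holds_const).

End Holds.

Lemma crun_frame n w c a (s : state n) : a \notin writes c -> crun w c s a = s a.
Proof.
elim: c s => [b e|c1 IH1 c2 IH2|c1 IH1] s /=.
- by rewrite inE; case: eqP.
- by rewrite mem_cat negb_or => /andP[h1 h2]; rewrite IH2 ?IH1.
- move=> h; have E k : iter k (crun w c1) s a = s a by elim: k => //= k IH; rewrite IH1.
  exact: E.
Qed.

Lemma crun_loop2 n w c (s : state n) :
  crun w (CLoop (CLoop c)) s = iter (n * n) (crun w c) s.
Proof. by rewrite /= iterM. Qed.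

Section First.
Variables (X : finType) (rank : X -> nat) (P : pred X).

(** Arrays are assigned pointwise, so a choice must be a predicate true of a single element; an
    injective rank breaks ties. *)
Definition first (x : X) : bool := P x && [forall y, ~~ P y || (rank x <= rank y)].

Lemma first_spec : injective rank ->
  P =1 xpred0 \/ exists2 x, P x & forall y, first y = (y == x).
Proof.
move=> inj; have [x Px|h] := pickP P; last by left.
right; have [x0 Px0 mn] := arg_minnP rank Px; exists x0 => // y.
rewrite /first; apply/andP/eqP => [[Py /forallP hy]|->].
  by apply: inj; apply/eqP; rewrite eqn_leq mn // andbT; move: (hy x0); rewrite Px0.
by split=> //; apply/forallP => z; case: (boolP (P z)) => //= /mn.
Qed.

End First.

Definition rank2 n (p : 'I_n * 'I_n) : nat := p.1 + n * p.2.

Lemma rank2_inj n : injective (@rank2 n).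
Proof.
move=> [a b] [c d]; rewrite /rank2 /= => e.
have n0 : 0 < n by apply: leq_ltn_trans (ltn_ord a).
have e1 : a = c :> nat.
  by move: (congr1 (modn^~ n) e); rewrite !(addnC _ (n * _)) !(mulnC n) !modnMDl !modn_small.
move: e; rewrite e1 => /addnI /eqP; rewrite eqn_pmul2l // => /eqP e2.
by congr (_, _); apply: val_inj.
Qed.

Definition rank4 n (p : ('I_n * 'I_n) * ('I_n * 'I_n)) : nat :=
  p.1.1 + n * (p.1.2 + n * (rank2 p.2)).

Lemma rank4_inj n : injective (@rank4 n).
Proof.
move=> [[a b] r] [[c d] r']; rewrite /rank4 /= => e.
have n0 : 0 < n by apply: leq_ltn_trans (ltn_ord a).
have D (x y : 'I_n) u v : x + n * u = y + n * v -> x = y /\ u = v.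
  move=> e'; have e1 : x = y :> nat.
    by move: (congr1 (modn^~ n) e'); rewrite !(addnC _ (n * _)) !(mulnC n) !modnMDl !modn_small.
  split; first exact: val_inj.
  by move: e'; rewrite e1 => /addnI /eqP; rewrite eqn_pmul2l // => /eqP.
by have [-> /D[-> /rank2_inj ->]] := D _ _ _ _ e.
Qed.

(** Summing over a variable absent from the body multiplies by [n]; the variables from 9 on serve as
    such dummies. *)
Definition tRank2 (u v : nat) : term := TAdd (TVar u) (TSum 9 (TVar v)).
Definition tRank4 (u v x y : nat) : term :=
  TAdd (TVar u) (TSum 10 (TAdd (TVar v) (TSum 11 (TAdd (TVar x) (TSum 12 (TVar y)))))).

(* Arrays: [aE] edges of the complement still to be oriented, [aO] the orientation,
   [aA0] the next edge, [aA] its implication class, [aD] the relation [steps],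
   [aAl] the number [alpha G], [aR] the relation [sq], [aQ] the number [alpha G - d],
   [aG] the relation [pgraph], [aM] the matching, [aP] the prices, [aC] the
   admissible bids, [aB] the selected bid.  Lower-dimensional ones do not depend
   on their last indices. *)
Definition aE := 0.
Definition aO := 1.
Definition aA0 := 2.
Definition aA := 3.
Definition aD := 4.
Definition aAl := 5.
Definition aR := 6.
Definition aQ := 7.
Definition aG := 8.
Definition aM := 9.
Definition aP := 10.
Definition aC := 11.
Definition aB := 12.

Definition pick_edge : command :=
  CSet aA0 (tAnd (TArr aE 0 1 0 0) (tAll 4 (tAll 5
    (tOr (tNot (TArr aE 4 5 4 4)) (tLe (tRank2 0 1) (tRank2 4 5)))))).

Definition gamma_cmd : command :=
  CSet aA (tOr (TArr aA0 0 1 0 0) (tAnd (TArr aE 0 1 0 0) (TSum 4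
    (tOr (tAnd (TArr aA 0 4 0 0) (tNot (TArr aE 4 1 0 0)))
         (tAnd (TArr aA 4 1 0 0) (tNot (TArr aE 4 0 0 0))))))).

Definition class_cmd : command :=
  CSeq pick_edge (CSeq (CSet aA (TConst 0)) (CLoop (CLoop gamma_cmd))).

Definition orient_step : command :=
  CSeq class_cmd
 (CSeq (CSet aO (tOr (TArr aO 0 1 0 0) (TArr aA 0 1 0 0)))
       (CSet aE (tAnd (TArr aE 0 1 0 0) (tNot (tOr (TArr aA 0 1 0 0) (TArr aA 1 0 0 0)))))).

Definition complement_cmd : command :=
  CSeq (CSet aE (tAnd (tNot (tEq (TVar 0) (TVar 1))) (tNot (TAdj 0 1))))
       (CSet aO (TConst 0)).

(** At most [n * n] pairs can be removed; the extra step brings the count strictly above this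
    bound. *)
Definition orient_cmd : command :=
  CSeq complement_cmd (CSeq (CLoop (CLoop orient_step)) orient_step).

(** * Correctness of the orientation stage *)

Section OrientCorrect.
Variables (n : nat) (w : memory).
Local Notation T := 'I_n.
Implicit Types (s : state n) (e : rel T).

Definition rep (s : state n) (a : nat) (e : rel T) : Prop :=
  forall i j k l, (s a i j k l != 0) = e i j.

Lemma pick_edge_correct s e : rep s aE e ->
  rep (crun w pick_edge s) aA0
    (fun i j => (i, j) \in [set p | first (@rank2 n) (fun p => e p.1 p.2) p]).
Proof.
move=> hE i j k l; transitivity (holds w s (env4 i j k l)
  (tAnd (TArr aE 0 1 0 0) (tAll 4 (tAll 5
    (tOr (tNot (TArr aE 4 5 4 4)) (tLe (tRank2 0 1) (tRank2 4 5))))))) => //.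
rewrite !holdsE /= hE inE /first /=; congr (_ && _).
apply/forallP/forallP => h.
  move=> [u v]; have := h u; rewrite holds_all => /forallP/(_ v).
  by rewrite !holdsE /= hE /rank2 /= !sum_nat_const !card_ord.
move=> u; rewrite holds_all; apply/forallP => v; have := h (u, v).
by rewrite !holdsE /= hE /rank2 /= !sum_nat_const !card_ord.
Qed.

Lemma gamma_cmd_correct s e (A0 A : {set T * T}) : rep s aE e ->
  rep s aA0 (fun i j => (i, j) \in A0) ->
  rep s aA (fun i j => (i, j) \in A) ->
  rep (crun w gamma_cmd s) aA
    (fun i j => (i, j) \in A0 :|: gamma_step e A).
Proof.
move=> hE hA0 hA i j k l.
transitivity (holds w s (env4 i j k l) (tOr (TArr aA0 0 1 0 0) (tAnd (TArr aE 0 1 0 0) (TSum 4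
    (tOr (tAnd (TArr aA 0 4 0 0) (tNot (TArr aE 4 1 0 0)))
         (tAnd (TArr aA 4 1 0 0) (tNot (TArr aE 4 0 0 0)))))))); first by [].
rewrite !holdsE /= hE hA0 in_setU; congr (_ || _); rewrite inE /=; congr (_ && _).
by apply: eq_existsb => z; rewrite !holdsE /= !hA !hE.
Qed.

Lemma class_cmd_correct s e : rep s aE e -> let s' := crun w class_cmd s in
  [/\ s' aE = s aE, s' aO = s aO & rep s' aA (fun i j => (i, j) \in
    gamma_closure e [set p | first (@rank2 n) (fun p => e p.1 p.2) p])].
Proof.
move=> hE s'; split; [by rewrite /s' crun_frame | by rewrite /s' crun_frame |].
rewrite (_ : s' = crun w (CLoop (CLoop gamma_cmd))
  (crun w (CSet aA (TConst 0)) (crun w pick_edge s))) // crun_loop2.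
set s1 := crun w pick_edge s; have hA0 := pick_edge_correct hE; rewrite -/s1 in hA0.
set A0 := [set p | _] in hA0 *; set s2 := crun w (CSet aA (TConst 0)) s1.
(* The two nested loops perform exactly the iterations from the empty set that define [fixset]. *)
have -> : n * n = #|{: T * T}| by rewrite card_prod card_ord.
rewrite /gamma_closure /fixset; set F := fun A : {set T * T} => _.
pose st k := iter k (crun w gamma_cmd) s2.
suff H k : [/\ rep (st k) aE e, rep (st k) aA0 (fun i j => (i, j) \in A0) &
    rep (st k) aA (fun i j => (i, j) \in iter k F set0)].
  by case: (H #|{: T * T}|).
elim: k => [|k [h1 h2 h3]]; first by split=> // i j k l; rewrite inE.
rewrite /st !iterS -/(st k); split.
- by rewrite /rep crun_frame.
- by rewrite /rep crun_frame.
- exact: gamma_cmd_correct.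
Qed.

(** One orientation of the remaining edges exists, and every one of them completes [o]. At
    exhaustion the empty relation is such an orientation, so [o] itself orients [e0]. *)
Definition oriented (e0 : rel T) s : Prop := exists e o,
  [/\ rep s aE e, rep s aO o, exists F, torient e F &
      forall G, torient e G -> torient e0 (fun x y => o x y || G x y)].

Definition exhausted s : Prop := forall i j k l, s aE i j k l = 0.

Definition progress s : nat := #|[set p : T * T | s aE p.1 p.2 p.1 p.1 == 0]|.

Lemma torient_eq e e' F F' : e =2 e' -> F =2 F' -> torient e F -> torient e' F'.
Proof.
move=> ee ff [h1 h2 h3]; split=> [x y|x y|y x z]; rewrite -?ee -!ff //; first exact: h2.
exact: h3.
Qed.

Lemma orient_step_correct e0 s : oriented e0 s -> let s' := crun w orient_step s in
  [/\ oriented e0 s', exhausted s -> exhausted s' & exhausted s \/ progress s < progress s'].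
Proof.
move=> [e [o [hE hO [F oF] hG]]] s'.
have [eqE eqO hA] := class_cmd_correct hE; set s1 := crun w class_cmd s in eqE eqO hA.
set A0 := [set p | _] in hA; set A := gamma_closure e A0 in hA.
have hE1 : rep s1 aE e by rewrite /rep eqE.
have hO1 : rep s1 aO o by rewrite /rep eqO.
have hO' : rep s' aO (fun i j => o i j || ((i, j) \in A)).
  move=> i j k l; transitivity (holds w s1 (env4 i j k l) (tOr (TArr aO 0 1 0 0) (TArr aA 0 1 0 0))) => //.
  by rewrite !holdsE /= hO1 hA.
have hE' : rep s' aE (erem e A).
  move=> i j k l; pose s2 := crun w (CSet aO (tOr (TArr aO 0 1 0 0) (TArr aA 0 1 0 0))) s1.
  transitivity (holds w s2 (env4 i j k l) (tAnd (TArr aE 0 1 0 0) (tNot (tOr (TArr aA 0 1 0 0) (TArr aA 1 0 0 0))))) => //.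
  by rewrite !holdsE /= hE1 !hA.
case: (first_spec (fun p : T * T => e p.1 p.2) (@rank2_inj n)) => [e0'|[[u v] /= uv fst]].
  have ee x y : e x y = false by apply: (e0' (x, y)).
  have ee' : e =2 erem e A by move=> x y; rewrite /erem ee.
  have An x y : ((x, y) \in A) = false.
    by rewrite /A gamma_closureE !inE /first /= !ee.
  have ex : exhausted s by move=> i j k l; apply/eqP/negbFE; rewrite hE ee.
  have ex' : exhausted s' by move=> i j k l; apply/eqP/negbFE; rewrite hE' -ee' ee.
  split=> //; last by left.
  exists e, o; split=> //.
  - by move=> i j k l; rewrite hE' -ee'.
  - by move=> i j k l; rewrite hO' An orbF.
  - by exists F.
have Aeq : A0 = [set (u, v)] by apply/setP => p; rewrite !inE fst.
have cA : implication_class e A.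
  by rewrite /A Aeq; apply: gamma_closure_class => //; apply: torient_sym oF.
have uvA : (u, v) \in A by rewrite /A gamma_closureE Aeq !inE eqxx.
split.
- exists (erem e A), (fun i j => o i j || ((i, j) \in A)); split=> //.
    exact: remainder_orientable cA oF.
  move=> G oG; have := hG _ (union_torient cA oF oG).
  by apply: torient_eq => // x y; rewrite orbA.
- by move=> h; move: (hE u v u u); rewrite h uv.
- right; apply: proper_card; rewrite properE; apply/andP; split.
    apply/subsetP => -[x y]; rewrite !inE /= => h.
    by apply/negbFE; rewrite hE' /erem -(hE x y x x) h.
  apply/subsetPn; exists (u, v); rewrite !inE /=.
    by apply/negbFE; rewrite hE' /erem /ehat uvA andbF.
  by rewrite hE uv.
Qed.

Lemma orient_cmd_correct (G : sgraph T) s : cocomparability G ->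
  (forall i j : T, i != j -> w (3 + (i * n + j)) = adj G i j) ->
  exists2 F, torient (compl_adj G) F & rep (crun w orient_cmd s) aO F.
Proof.
move=> cG hw; set e0 := compl_adj G; set s0 := crun w complement_cmd s.
have g0 : oriented e0 s0.
  exists e0, (fun _ _ => false); split=> //; last exact: cocomparability_torient.
  move=> i j k l.
  transitivity (holds w s (env4 i j k l) (tAnd (tNot (tEq (TVar 0) (TVar 1))) (tNot (TAdj 0 1)))) => //.
  rewrite !holdsE /holds /e0 /compl_adj /= -(val_eqE i j).
  case: eqP => //= /eqP ne; rewrite hw //; by case: (adj G i j).
have E : crun w orient_cmd s = iter (n * n).+1 (crun w orient_step) s0.
  by rewrite iterS -crun_loop2.
have [||||||g st] := @iter_until _ (crun w orient_step) (oriented e0) exhausted progress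
    (n * n) s0 (n * n).+1.
- by move=> s1 /orient_step_correct[].
- by move=> s1 /orient_step_correct[].
- by move=> s1 /orient_step_correct[].
- by move=> s1 _; apply: leq_trans (max_card _) _; rewrite card_prod card_ord.
- by [].
- by [].
rewrite E; case: g => e [o [hE hO [F' oF'] hG]].
have e_0 x y : e x y = false by rewrite -(hE x y x x) st.
exists o => //; apply: torient_eq (hG (fun _ _ => false) _) => //.
by move=> x y; rewrite orbF.
Qed.

End OrientCorrect.

(** * Path lengths, [alpha G], [sq] and the product graph *)

Definition step_cmd : command :=
  CSet aD (TIf (TVar 2)
    (TSum 4 (TSum 5 (tAnd (tEq (TAdd (TVar 5) (TConst 1)) (TVar 2))
                          (tAnd (TArr aD 0 4 5 5) (TArr aO 4 1 4 4)))))
    (tEq (TVar 0) (TVar 1))).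

Definition alpha_cmd : command :=
  CSet aAl (TSum 4 (tBit (TSum 5 (TSum 6 (TArr aD 5 6 4 4))))).

Definition sq_cmd : command :=
  CSet aR (TSum 4 (TSum 5 (TSum 6 (TSum 7 (TSum 8
    (tAnd (TArr aD 4 0 6 6) (tAnd (TArr aD 0 1 7 7) (tAnd (TArr aD 1 5 8 8)
      (tEq (TAdd (TAdd (TAdd (TVar 6) (TVar 7)) (TVar 8)) (TConst 1))
           (TArr aAl 0 0 0 0)))))))))).

Definition pgraph_cmd : command :=
  CSet aG (tAnd (TArr aR 0 2 0 0) (tAnd (tLe (TVar 1) (TVar 3))
    (tAnd (tLt (TVar 3) (TArr aQ 0 0 0 0))
      (tNot (tAnd (tEq (TVar 0) (TVar 2)) (tEq (TVar 1) (TVar 3))))))).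

Definition chains_cmd : command :=
  CSeq (CLoop step_cmd) (CSeq alpha_cmd (CSeq sq_cmd
    (CSeq (CSet aQ (TSub (TArr aAl 0 0 0 0) TD)) pgraph_cmd))).

Section ChainsCorrect.
Variables (n : nat) (w : memory) (G : sgraph 'I_n) (F : rel 'I_n).
Hypothesis oF : torient (compl_adj G) F.
Implicit Types s : state n.

(** Every round recomputes all lengths at once; after [k] rounds the entries of length below [k] are
    right, whatever the array held initially. *)
Lemma steps_cmd_correct s : rep s aO F -> let s' := crun w (CLoop step_cmd) s in
  rep s' aO F /\ forall x y t l, (s' aD x y t l != 0) = steps F t x y.
Proof.
move=> hO s'.
pose st k := iter k (crun w step_cmd) s.
suff H k : rep (st k) aO F /\ forall x y (t l : 'I_n), t < k -> (st k aD x y t l != 0) = steps F t x y.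
  by have [h1 h2] := H n; split=> // x y t l; apply: h2.
elim: k => [|k [h1 h2]]; first by split.
rewrite /st iterS -/(st k); split; first by rewrite /rep crun_frame.
move=> x y t l; rewrite ltnS => tk.
transitivity (holds w (st k) (env4 x y t l) (TIf (TVar 2)
    (TSum 4 (TSum 5 (tAnd (tEq (TAdd (TVar 5) (TConst 1)) (TVar 2))
                          (tAnd (TArr aD 0 4 5 5) (TArr aO 4 1 4 4)))))
    (tEq (TVar 0) (TVar 1)))) => //.
rewrite holds_if [holds _ _ _ (TVar 2)]/holds /=.
case: t tk => -[|t] ht tk /=; first by rewrite holdsE.
rewrite holdsE; apply: eq_existsb => z; rewrite holdsE.
have ht' : t < n := ltnW ht.
apply/existsP/andP => [[u]|[h3 h4]].
  rewrite !holdsE /= h1 addn1 eqSS => /and3P[/eqP ut h3 h4]; split; last exact: h4.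
  have {}ut : nat_of_ord u = t by exact: ut.
  by rewrite -ut -(h2 x z u u) ?ut.
exists (Ordinal ht'); rewrite !holdsE /= h1 addn1 eqxx h4 andbT /=.
by rewrite (h2 x z (Ordinal ht')).
Qed.

Lemma sum_bits (X : finType) (P : pred X) : \sum_x (if P x then 1 else 0) = #|[set x | P x]|.
Proof. by rewrite -big_mkcond sum1dep_card. Qed.

Lemma alpha_le : alpha G <= n.
Proof. by apply/bigmax_leqP => I _; rewrite -[leqRHS]card_ord max_card. Qed.

Lemma alpha_cmd_correct s : (forall x y t l, (s aD x y t l != 0) = steps F t x y) ->
  forall i j k l, crun w alpha_cmd s aAl i j k l = alpha G.
Proof.
move=> hD i j k l.
transitivity (\sum_(t < n) if holds w s (upd (env4 i j k l) 4 t)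
  (TSum 5 (TSum 6 (TArr aD 5 6 4 4))) then 1 else 0) => //.
rewrite sum_bits -[RHS](card_ord_lt alpha_le); apply: eq_card => t; rewrite [RHS]inE.
rewrite inE holdsE; apply/existsP/idP => [[x]|/(steps_lt_alpha oF)[x [y h]]].
  rewrite holdsE => /existsP[y]; rewrite holdsE /= hD => h.
  by apply/(steps_lt_alpha oF); exists x, y.
by exists x; rewrite holdsE; apply/existsP; exists y; rewrite holdsE /= hD.
Qed.

Lemma sq_cmd_correct s : (forall x y t l, (s aD x y t l != 0) = steps F t x y) ->
  (forall i j k l, s aAl i j k l = alpha G) -> rep (crun w sq_cmd s) aR (sq G F).
Proof.
move=> hD hA i j k l.
transitivity (holds w s (env4 i j k l) (TSum 4 (TSum 5 (TSum 6 (TSum 7 (TSum 8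
    (tAnd (TArr aD 4 0 6 6) (tAnd (TArr aD 0 1 7 7) (tAnd (TArr aD 1 5 8 8)
      (tEq (TAdd (TAdd (TAdd (TVar 6) (TVar 7)) (TVar 8)) (TConst 1))
           (TArr aAl 0 0 0 0))))))))))) => //.
apply/idP/idP => [|h]; last first.
  have [a [b [t1 [t2 [t3 [h1 h2 h3 e]]]]]] := proj1 (sq_steps oF i j) h.
  (* The three lengths add up to [alpha G - 1], so they are below [n] and can serve as indices. *)
  have le := alpha_le.
  have l1 : t1 < n by lia.
  have l2 : t2 < n by lia.
  have l3 : t3 < n by lia.
  rewrite holdsE; apply/existsP; exists a; rewrite holdsE; apply/existsP; exists b.
  rewrite holdsE; apply/existsP; exists (Ordinal l1).
  rewrite holdsE; apply/existsP; exists (Ordinal l2).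
  rewrite holdsE; apply/existsP; exists (Ordinal l3).
  by rewrite !holdsE /= !hD hA /= h1 h2 h3 e eqxx.
rewrite holdsE => /existsP[a]; rewrite holdsE => /existsP[b].
rewrite holdsE => /existsP[t1]; rewrite holdsE => /existsP[t2].
rewrite holdsE => /existsP[t3]; rewrite !holdsE /= !hD hA => /and4P[h1 h2 h3 /eqP h4].
by apply: (proj2 (sq_steps oF i j)); exists a, b, t1, t2, t3.
Qed.

Lemma chains_cmd_correct s : rep s aO F -> let s' := crun w chains_cmd s in
  [/\ forall i j k l, s' aAl i j k l = alpha G, rep s' aR (sq G F),
      forall i j k l, s' aQ i j k l = alpha G - w 1 &
      forall i j k l, (s' aG i j k l != 0) = pgraph G F (w 1) (i, j) (k, l)].
Proof.
move=> /steps_cmd_correct [hO hD] s'.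
set s1 := crun w (CLoop step_cmd) s in hO hD; pose s2 := crun w alpha_cmd s1.
pose s3 := crun w sq_cmd s2; pose s4 := crun w (CSet aQ (TSub (TArr aAl 0 0 0 0) TD)) s3.
have es : s' = crun w pgraph_cmd s4 by [].
have hA : forall i j k l, s2 aAl i j k l = alpha G by apply: alpha_cmd_correct.
have hR : rep s3 aR (sq G F) by apply: sq_cmd_correct hA => x y t l; rewrite /s2 crun_frame.
have hQ i j k l : s4 aQ i j k l = alpha G - w 1 by rewrite /s4 /= /s3 crun_frame // hA.
have hR4 : rep s4 aR (sq G F) by rewrite /rep /s4 crun_frame.
split.
- by move=> i j k l; rewrite es crun_frame // /s4 crun_frame // /s3 crun_frame.
- by rewrite /rep es crun_frame.
- by move=> i j k l; rewrite es crun_frame.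
- move=> i j k l; rewrite es.
  transitivity (holds w s4 (env4 i j k l) (tAnd (TArr aR 0 2 0 0) (tAnd (tLe (TVar 1) (TVar 3))
    (tAnd (tLt (TVar 3) (TArr aQ 0 0 0 0))
      (tNot (tAnd (tEq (TVar 0) (TVar 2)) (tEq (TVar 1) (TVar 3)))))))) => //.
  by rewrite !holdsE /= hR4 hQ /pgraph /= xpair_eqE.
Qed.

End ChainsCorrect.

(** * The auction stage *)

(** The cap [#|R|.+1] for the [n * n] right vertices. *)
Definition tCap : term := TAdd (TSum 9 (TSum 10 (TConst 1))) (TConst 1).

Definition can_bid_cmd : command :=
  CSet aC (tAnd (TArr aG 0 1 2 3) (tAnd (tNot (TSum 4 (TSum 5 (TArr aM 0 1 4 5))))
    (tAnd (tLt (TArr aP 2 3 2 2) tCap)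
      (tAll 4 (tAll 5 (tOr (tNot (TArr aG 0 1 4 5))
                           (tLe (TArr aP 2 3 2 2) (TArr aP 4 5 4 4)))))))).

Definition pick_bid : command :=
  CSet aB (tAnd (TArr aC 0 1 2 3) (tAll 4 (tAll 5 (tAll 6 (tAll 7
    (tOr (tNot (TArr aC 4 5 6 7)) (tLe (tRank4 0 1 2 3) (tRank4 4 5 6 7)))))))).

(** The whole column of the right vertex receiving the bid is replaced, which matches the bidder and
    evicts the former owner at once. *)
Definition match_cmd : command :=
  CSet aM (TIf (TSum 4 (TSum 5 (TArr aB 4 5 2 3))) (TArr aB 0 1 2 3) (TArr aM 0 1 2 3)).

Definition raise_cmd : command :=
  CSet aP (TAdd (TArr aP 0 1 0 0) (tBit (TSum 4 (TSum 5 (TArr aB 4 5 0 1))))).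

Definition bid_cmd : command :=
  CSeq can_bid_cmd (CSeq pick_bid (CSeq match_cmd raise_cmd)).

(** The price sum is at most [n ^ 2 * (n ^ 2 + 1)]. One more bid than that is [1 + n ^ 2 + n ^ 4],
    hence the three blocks. *)
Definition auction_cmd : command :=
  CSeq (CSeq (CSet aM (TConst 0)) (CSet aP (TConst 0)))
    (CSeq bid_cmd (CSeq (CLoop (CLoop bid_cmd)) (CLoop (CLoop (CLoop (CLoop bid_cmd)))))).

Section AuctionCorrect.
Variables (n : nat) (w : memory) (E : 'I_n * 'I_n -> 'I_n * 'I_n -> bool).
Implicit Types s : state n.
Local Notation V := ('I_n * 'I_n)%type.

Definition matching_of s (l r : V) : bool := s aM l.1 l.2 r.1 r.2 != 0.
Definition price_of s (r : V) : nat := s aP r.1 r.2 r.1 r.1.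

Definition auctioned s : Prop :=
  [/\ forall i j k l, (s aG i j k l != 0) = E (i, j) (k, l),
      forall i j k l, s aP i j k l = price_of s (i, j) &
      auction_inv E (matching_of s) (price_of s)].

Definition stuck s : Prop := forall l r, ~~ can_bid E (matching_of s) (price_of s) l r.

Lemma can_bid_cmd_correct s : auctioned s -> let s' := crun w can_bid_cmd s in
  forall i j k l, (s' aC i j k l != 0) = can_bid E (matching_of s) (price_of s) (i, j) (k, l).
Proof.
move=> [hG hP _] s' i j k l.
transitivity (holds w s (env4 i j k l)
  (tAnd (TArr aG 0 1 2 3) (tAnd (tNot (TSum 4 (TSum 5 (TArr aM 0 1 4 5))))
    (tAnd (tLt (TArr aP 2 3 2 2) tCap)
      (tAll 4 (tAll 5 (tOr (tNot (TArr aG 0 1 4 5))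
                           (tLe (TArr aP 2 3 2 2) (TArr aP 4 5 4 4))))))))) => //.
rewrite !holdsE /= hG hP /can_bid !sum_nat_const !card_ord muln1 card_prod card_ord addn1.
congr [&& _, ~~ _, _ & _].
  apply/existsP/existsP => [[u]|[[u v] h]].
    by rewrite holdsE => /existsP[v h]; exists (u, v).
  by exists u; rewrite holdsE; apply/existsP; exists v.
apply/forallP/forallP => [h [u v]|h u].
  by have := h u; rewrite holdsE => /forallP/(_ v); rewrite !holdsE /= hG !hP implybE.
rewrite holdsE; apply/forallP => v; rewrite !holdsE /= hG !hP.
by have := h (u, v); rewrite implybE.
Qed.

Lemma pick_bid_correct s (C : V -> V -> bool) :
  (forall i j k l, (s aC i j k l != 0) = C (i, j) (k, l)) ->
  forall i j k l, (crun w pick_bid s aB i j k l != 0) =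
    first (@rank4 n) (fun p => C p.1 p.2) ((i, j), (k, l)).
Proof.
move=> hC i j k l.
transitivity (holds w s (env4 i j k l)
  (tAnd (TArr aC 0 1 2 3) (tAll 4 (tAll 5 (tAll 6 (tAll 7
    (tOr (tNot (TArr aC 4 5 6 7)) (tLe (tRank4 0 1 2 3) (tRank4 4 5 6 7))))))))) => //.
rewrite !holdsE /= hC /first /=; congr (_ && _).
apply/forallP/forallP => [h [[a b] [c d]]|h a].
  have := h a; rewrite holdsE => /forallP/(_ b); rewrite holdsE => /forallP/(_ c).
  rewrite holdsE => /forallP/(_ d); rewrite !holdsE /= hC /rank4 /rank2 /upd /=.
  by rewrite !sum_nat_const !card_ord.
rewrite holdsE; apply/forallP => b; rewrite holdsE; apply/forallP => c.
rewrite holdsE; apply/forallP => d; have := h ((a, b), (c, d)).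
by rewrite !holdsE /= hC /rank4 /rank2 /upd /= !sum_nat_const !card_ord.
Qed.

Lemma bid_cmd_correct s : auctioned s -> let s' := crun w bid_cmd s in
  [/\ auctioned s', stuck s -> stuck s' &
      stuck s \/ \sum_r price_of s r < \sum_r price_of s' r].
Proof.
move=> gs s'; have hC := can_bid_cmd_correct gs; case: (gs) => hG hP inv.
set s1 := crun w can_bid_cmd s in hC; have hB := pick_bid_correct hC.
set s2 := crun w pick_bid s1 in hB; set f := first _ _ in hB.
have hM2 i j k l : s2 aM i j k l = s aM i j k l by rewrite /s2 crun_frame // /s1 crun_frame.
have hP2 i j k l : s2 aP i j k l = s aP i j k l by rewrite /s2 crun_frame // /s1 crun_frame.
set s3 := crun w match_cmd s2; have es : s' = crun w raise_cmd s3 by [].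
have hM' i j k l : (s' aM i j k l != 0) =
    if [exists x, f (x, (k, l))] then f ((i, j), (k, l)) else matching_of s (i, j) (k, l).
  rewrite es crun_frame //; transitivity (holds w s2 (env4 i j k l)
    (TIf (TSum 4 (TSum 5 (TArr aB 4 5 2 3))) (TArr aB 0 1 2 3) (TArr aM 0 1 2 3))) => //.
  rewrite holds_if !holdsE /= hB hM2; congr (if _ then _ else _).
  apply/existsP/existsP => [[u]|[[u v] h]].
    by rewrite holdsE => /existsP[v]; rewrite holdsE /= hB => h; exists (u, v).
  by exists u; rewrite holdsE; apply/existsP; exists v; rewrite holdsE /= hB.
have hP' i j k l : s' aP i j k l = price_of s (i, j) + [exists x, f (x, (i, j))].
  transitivity (s3 aP i j i i + teval w s3 (env4 i j k l) (tBit (TSum 4 (TSum 5 (TArr aB 4 5 0 1))))).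
    by [].
  rewrite /s3 crun_frame // hP2 hP; congr (_ + _).
  have -> : [exists x, f (x, (i, j))] =
      holds w s3 (env4 i j k l) (TSum 4 (TSum 5 (TArr aB 4 5 0 1))).
    rewrite holdsE; apply/existsP/existsP => [[[u v] h]|[u]].
      by exists u; rewrite holdsE; apply/existsP; exists v; rewrite holdsE /= /s3 crun_frame // hB.
    by rewrite holdsE => /existsP[v]; rewrite holdsE /= /s3 crun_frame // hB => h; exists (u, v).
  by rewrite /holds /=; case: ifP.
have hG' i j k l : (s' aG i j k l != 0) = E (i, j) (k, l).
  by rewrite es crun_frame // /s3 crun_frame // /s2 crun_frame // /s1 crun_frame.
case: (first_spec (fun p => can_bid E (matching_of s) (price_of s) p.1 p.2) (@rank4_inj n)).
  move=> no; have st : stuck s by move=> l r; apply/negP => h; have := no (l, r); rewrite /= h.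
  have f0 p : f p = false by rewrite /f /first no.
  have nx r : [exists x, f (x, r)] = false by apply/existsP => -[x]; rewrite f0.
  have eM : matching_of s =2 matching_of s'.
    by move=> [i j] [k l]; rewrite {2}/matching_of /= hM' nx.
  have eP : price_of s =1 price_of s'.
    by move=> [i j]; rewrite [RHS]/price_of /= hP' nx addn0.
  split; [split=> //|move=> _ l r|by left].
  - exact: (auction_inv_eq eM eP inv).
  - apply: contra (st l r); rewrite /can_bid eP => /and4P[-> h1 -> h2]; rewrite /= andbC.
    apply/andP; split.
      apply/forallP => r'; have /forallP/(_ r') := h2; by rewrite !eP.
    by apply: contra h1 => /existsP[r' h]; apply/existsP; exists r'; rewrite -eM.
move=> [[l0 r0] /= bid fst].
have nx r : [exists x, f (x, r)] = (r == r0).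
  apply/existsP/eqP => [[x]|->]; first by rewrite /f fst => /eqP[_ ->].
  by exists l0; rewrite /f fst.
have eM : (fun x y => if y == r0 then x == l0 else matching_of s x y) =2 matching_of s'.
  move=> [i j] [k l]; rewrite [RHS]/matching_of /= hM' nx /f fst.
  by case: eqP => //= ->; rewrite [RHS]xpair_eqE eqxx andbT.
have eP : (fun y => price_of s y + (y == r0)) =1 price_of s'.
  by move=> [i j]; rewrite [RHS]/price_of /= hP' nx.
split; [split=> //|by move=> st; move: (st l0 r0); rewrite bid|right].
- exact: (auction_inv_eq eM eP (bid_inv inv bid)).
- by rewrite -(eq_bigr _ (fun r _ => eP r)) sum_bid addn1.
Qed.

Lemma auction_cmd_correct s : (forall i j k l, (s aG i j k l != 0) = E (i, j) (k, l)) ->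
  let s' := crun w auction_cmd s in auctioned s' /\ stuck s'.
Proof.
move=> hG s'; set s0 := crun w (CSeq (CSet aM (TConst 0)) (CSet aP (TConst 0))) s.
have g0 : auctioned s0 by split=> //; exact: auction_inv0.
pose N := n * n * (n * n).+1.
have -> : s' = iter N.+1 (crun w bid_cmd) s0.
  have -> : N.+1 = n * n * (n * n) + (n * n + 1) by rewrite /N mulnS; lia.
  rewrite !iterD iterM -crun_loop2.
  transitivity (crun w (CLoop (CLoop (CLoop (CLoop bid_cmd))))
    (crun w (CLoop (CLoop bid_cmd)) (crun w bid_cmd s0))); first by [].
  rewrite crun_loop2; apply: eq_iter => s1; exact: crun_loop2.
apply: (@iter_until _ _ _ _ (fun s => \sum_r price_of s r) N) => //.
- by move=> s1 /bid_cmd_correct[].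
- by move=> s1 /bid_cmd_correct[].
- by move=> s1 /bid_cmd_correct[].
- by move=> s1 [_ _ /auction_sum]; rewrite card_prod card_ord.
Qed.

End AuctionCorrect.

(** * Evaluation of the min-max criterion *)

Definition card_U : term := TSum 4 (tBit (TArr aR 4 4 4 4)).
Definition card_Uq : term := TSum 4 (TIf (TArr aR 4 4 4 4) (TArr aQ 4 4 4 4) (TConst 0)).
Definition card_M : term := TSum 4 (TSum 5 (TSum 6 (TSum 7 (tBit (TArr aM 4 5 6 7))))).

Definition answer : term :=
  tBit (tAnd (tLe TD (TArr aAl 0 0 0 0)) (tLe (TAdd card_U card_M) (TAdd TK card_Uq))).

Definition transversal_cmd : command := CSeq orient_cmd (CSeq chains_cmd auction_cmd).

Lemma answer_correct n (w : memory) (G : sgraph 'I_n) (s : state n) (r : nat -> 'I_n) :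
  cocomparability G -> 0 < w 1 ->
  (forall i j : 'I_n, i != j -> w (3 + (i * n + j)) = adj G i j) ->
  let v := teval w (crun w transversal_cmd s) r answer in
  (v = 1 /\ has_transversal G (w 1) (w 2)) \/ (v = 0 /\ ~ has_transversal G (w 1) (w 2)).
Proof.
move=> cG d1 hw; have [F oF hO] := orient_cmd_correct s cG hw.
have [hA hR hQ hG] := chains_cmd_correct w oF hO.
have [[_ _ inv] st] := auction_cmd_correct w hG.
set s1 := crun w orient_cmd s in hO hA hR hQ hG inv st.
set s2 := crun w chains_cmd s1 in hA hR hQ hG inv st.
set s3 := crun w auction_cmd s2 in inv st.
move=> v; have -> : v = teval w s3 r answer by [].
have {}hA : s3 aAl (r 0) (r 0) (r 0) (r 0) = alpha G by rewrite /s3 crun_frame.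
have {}hR : rep s3 aR (sq G F) by rewrite /rep /s3 crun_frame.
have {}hQ i j k l : s3 aQ i j k l = alpha G - w 1 by rewrite /s3 crun_frame.
set q := alpha G - w 1 in hQ.
have eU : teval w s3 r card_U = #|spanned G F|.
  transitivity (\sum_(i < n) if s3 aR i i i i != 0 then 1 else 0) => //.
  by rewrite sum_bits; apply: eq_card => i; rewrite !inE hR.
have eUq : teval w s3 r card_Uq = #|spanned G F| * q.
  transitivity (\sum_(i < n) if s3 aR i i i i != 0 then s3 aQ i i i i else 0) => //.
  rewrite -big_mkcond -sum_nat_const; apply: eq_big => [i|i _]; last exact: hQ.
  by rewrite hR inE.
have eM : teval w s3 r card_M = #|[set x | matching_of s3 x.1 x.2]|.
  rewrite -sum_bits -(pair_bigA _ (fun l r' => if matching_of s3 l r' then 1 else 0)) /=.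
  rewrite -(pair_bigA _ (fun i j => \sum_r' if matching_of s3 (i, j) r' then 1 else 0)) /=.
  apply: eq_bigr => i _; apply: eq_bigr => j _.
  by rewrite -(pair_bigA _ (fun k l => if matching_of s3 (i, j) (k, l) then 1 else 0)).
have Q0 : q <= n by rewrite (leq_trans (leq_subr _ _)) // alpha_le.
pose b := (w 1 <= alpha G) && (#|spanned G F| + #|[set x | matching_of s3 x.1 x.2]| <=
   w 2 + #|spanned G F| * q).
have -> : teval w s3 r answer = b.
  have -> : b = holds w s3 r (tAnd (tLe TD (TArr aAl 0 0 0 0))
     (tLe (TAdd card_U card_M) (TAdd TK card_Uq))).
    by rewrite !holdsE /b -eUq -eU -eM -hA.
  by rewrite /holds /=; case: ifP.
have key : has_transversal G (w 1) (w 2) <-> b.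
  split=> [[S [Sk hS]]|/andP[d_le le_k]].
    have [I hI] := maximum_independent_exists G.
    have d_le : w 1 <= alpha G.
      case/andP: (hI) => _ /eqP <-; apply: leq_trans (hS _ hI) _.
      by rewrite subset_leq_card // subsetIl.
    have [CL [CR [cov le]]] := cover_of_transversal oF d_le Q0 hS.
    rewrite /b d_le /= addnC.
    (* Weak duality: the matching found is at most the cover built from [S]. The converse direction
       uses the cover of equal size left by the stuck auction. *)
    apply: leq_trans (leq_add (matching_le_cover inv cov) (leqnn _)) _.
    by apply: leq_trans le _; rewrite -/q addnC leq_add2r.
  have [CL [CR [cov e]]] := auction_final inv st.
  have [|S [h1 h2]] := transversal_of_cover oF d_le Q0 (k := w 2) cov; last by exists S.
  by rewrite e -/q addnC [leqRHS]addnC.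
by case: (boolP b) key => _ [k1 k2]; [left | right]; split=> //; [apply: k2 | move/k1].
Qed.

Theorem theorem16 :
  poly_time_decidable encode_instance
    (fun x : instance => cocomparability (graph x))
    transversal_alpha.
Proof.
apply: (@array_program_decides transversal_cmd answer) => [x _ n0 [S [_ hS]]|x cx w s r [w1 w2 wadj]].
  (* Without vertices a maximum independent set is empty and cannot contain [d >= 1] elements of
     [S]. *)
  have [I hI] := maximum_independent_exists (graph x).
  have := leq_trans (leq_trans (dval_ge1 x) (hS I hI)) (max_card _).
  by rewrite card_ord n0.
rewrite /transversal_alpha -w1 -w2; apply: answer_correct => //.
by rewrite w1 dval_ge1.
Qed.
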